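(* Let $\mathfrak{g}_0$ be a compact semisimple Lie algebra, $\mathfrak{g}=\mathfrak{g}_0\otimes_{\mathbb{R}}\mathbb{C}$, and let $A$ be a $(\ast)$-subgroup of $G=\mathrm{Aut}(\mathfrak{g}_0)$. Suppose $\mathfrak{g}=\mathfrak{g}_{\infty}$. Then $\mathfrak{g}$ is $A$-simple if and only if $R'(G,A)$ is an irreducible root system.
   Context: A $(\ast)$-subgroup of a compact Lie group $G$ is a closed abelian subgroup $A$ with $\dim Z_G(A)=\dim A$. $A^0$ is the identity component of $A$, $X^*(A)=\mathrm{Hom}(A,\mathrm{U}(1))$ written additively. For $\lambda\in X^*(A)$, $\mathfrak{g}_\lambda=\{Y\in\mathfrak{g}: a\cdot Y=\lambda(a)Y\ \forall a\in A\}$, and $R(G,A)=\{\alpha\in X^*(A)-\{0\}:\mathfrak{g}_\alpha\neq0\}$. Put $R'(G,A)=\{\alpha|_{A^0}:\alpha\in R(G,A),\ \alpha|_{A^0}\ne0\}$; this is a (possibly non-reduced) root system in the lattice $X^*(A^0)$, with respect to the positive-definite inner product induced by a biinvariant Riemannian metric on $G$. It is irreducible if it cannot be partitioned into two nonempty mutually orthogonal subsets. For $\alpha'\in R'(G,A)$, $\mathfrak{g}'_{\alpha'}=\bigoplus_{\alpha\in R(G,A),\,\alpha|_{A^0}=\alpha'}\mathfrak{g}_\alpha$, and $$\mathfrak{g}_\infty=\Big(\bigoplus_{\alpha'\in R'(G,A)}\mathfrak{g}'_{\alpha'}\Big)\oplus\Big(\sum_{\alpha'\in R'(G,A)}[\mathfrak{g}'_{\alpha'},\mathfrak{g}'_{-\alpha'}]\Big).$$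 An $A$-ideal of $\mathfrak{g}$ is a complex ideal stable under the action of $A$; $\mathfrak{g}$ is $A$-simple if it has no nonzero proper $A$-ideal. *)

(* Defs.v *)
From HB Require Import structures.
From mathcomp Require Import all_boot all_order all_algebra.
From mathcomp Require Import all_classical all_reals all_analysis.
From mathcomp Require Export complex.

Set Implicit Arguments.
Unset Strict Implicit.
Unset Printing Implicit Defensive.

Import Order.TTheory GRing.Theory Num.Theory.
Import numFieldNormedType.Exports.
Import VectorInternalTheory.

Local Open Scope classical_set_scope.
Local Open Scope ring_scope.

Section Subspaces.
Context {K : nzRingType} {W : lmodType K}.

Definition subspace_set (U : set W) : Prop :=
  U 0 /\ forall (c : K) (u v : W), U u -> U v -> U (c *: u + v).

Definition span_set (S : set W) : set W := smallest subspace_set S.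

Definition sum_set (U U' : set W) : set W := [set u + v | u in U & v in U'].

End Subspaces.

(* The dimension of the set of vectors S, which is meant to be a linear
   subspace; junk value 0 when it is not. *)
Definition dim_set {K : fieldType} {W : vectType K} (S : set W) : nat :=
  \dim (xget 0%VS [set U : {vspace W} | [set u | u \in U] = S]).

(* Complexification: the pair (x, y) stands for x (x) 1 + y (x) i. *)

Definition cplx (R : rcfType) (V : lmodType R) : Type := (V * V)%type.

Section Complexification.
Context {R : rcfType} {V : lmodType R}.

HB.instance Definition _ := GRing.Zmodule.on (cplx V).

Definition cplx_scale (c : R[i]) (v : cplx V) : cplx V :=
  (complex.Re c *: v.1 - complex.Im c *: v.2,
   complex.Re c *: v.2 + complex.Im c *: v.1).

Fact cplx_scaleA (c d : R[i]) (v : cplx V) :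
  cplx_scale c (cplx_scale d v) = cplx_scale (c * d) v.
Proof.
case: c d v => [a b] [c d] [x y]; congr pair;
  rewrite /= scalerBr scalerDr !scalerA !scalerBl !scalerDl ?opprD.
  by rewrite (AC (2*2) ((1*4)*(2*3)))%AC.
by rewrite (AC (2*2) ((1*4)*(2*3)))%AC.
Qed.

Fact cplx_scale1 : left_id 1 cplx_scale.
Proof. by case=> x y; rewrite /cplx_scale /= !scale1r !scale0r subr0 addr0. Qed.

Fact cplx_scaleDr : right_distributive cplx_scale +%R.
Proof.
move=> [a b] [x y] [x' y']; congr pair; rewrite /= !scalerDr.
  by rewrite opprD addrACA.
by rewrite addrACA.
Qed.

Fact cplx_scaleDl (v : cplx V) : {morph cplx_scale^~ v : c d / c + d}.
Proof.
move: v => [x y] [a b] [c d]; congr pair; rewrite /= !scalerDl.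
  by rewrite opprD addrACA.
by rewrite addrACA.
Qed.

HB.instance Definition _ := GRing.Zmodule_isLmodule.Build R[i] (cplx V)
  cplx_scaleA cplx_scale1 cplx_scaleDr cplx_scaleDl.

End Complexification.

Section LieAlgebra.
Context {R : realType} {g0 : vectType R}.
Implicit Types (br : g0 -> g0 -> g0).

Record is_lie_bracket br : Prop := IsLieBracket {
  lie_linearl : forall y, linear (br^~ y);
  lie_linearr : forall x, linear (br x);
  lie_alternating : forall x, br x x = 0;
  lie_jacobi : forall x y z,
    br x (br y z) + br y (br z x) + br z (br x y) = 0
}.

Definition ad br (x : g0) : 'End(g0) := linfun (br x).

Definition killing br (x y : g0) : R := \tr (f2mx (ad br x \o ad br y)%VF).

Definition compact_semisimple br : Prop :=
  forall x, x != 0 -> killing br x x < 0.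

Definition lie_aut br : set 'End(g0) :=
  [set f : 'End(g0) | lker f == 0%VS /\
    forall x y, f (br x y) = br (f x) (f y)].

Definition cplx_br br (u v : cplx g0) : cplx g0 :=
  (br u.1 v.1 - br u.2 v.2, br u.1 v.2 + br u.2 v.1).

Definition cplx_act (a : 'End(g0)) (v : cplx g0) : cplx g0 := (a v.1, a v.2).

End LieAlgebra.

(* f2mx reads a linear map as a matrix in coordinates, so this is the usual
   topology of a finite-dimensional space of linear maps. *)
HB.instance Definition _ (R : realType) (V W : vectType R) :=
  PseudoMetric.copy 'Hom(V, W) (initial_topology (@f2mx R V W)).
HB.instance Definition _ (R : realType) (V W : vectType R) :=
  isPointed.Build 'Hom(V, W) 0.

(* Closed linear groups: a Lie group is a subgroup of GL(V) that is closed in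
   GL(V), and its Lie algebra is realized inside End(V). *)

Section LinearGroups.
Context {R : realType} {V : vectType R}.
Implicit Types (G A H : set 'End(V)) (m : 'End(V) -> 'End(V) -> R).

Definition lfun_exp (X : 'End(V)) : 'End(V) :=
  limn (series (fun k : nat => (k`!%:R : R)^-1 *: iter k (comp_lfun X) \1%VF)).

Definition lie_of H : set 'End(V) :=
  [set X : 'End(V) | forall t : R, H (lfun_exp (t *: X))].

Definition lie_dim H : nat := dim_set (lie_of H).

Definition subgroup H G : Prop :=
  [/\ H `<=` G, H \1%VF,
      (forall a b, H a -> H b -> H (a \o b)%VF) &
      (forall a, H a -> H (a^-1)%VF)].

Definition centralizer G A : set 'End(V) :=
  [set g : 'End(V) | G g /\ forall a, A a -> (g \o a = a \o g)%VF].

Definition id_comp H : set 'End(V) := connected_component H \1%VF.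

Definition star_subgroup G A : Prop :=
  [/\ subgroup A G,
      closed (A : set (subspace G)),
      (forall a b, A a -> A b -> (a \o b = b \o a)%VF) &
      lie_dim (centralizer G A) = lie_dim A].

(* A biinvariant Riemannian metric on G, given by its value at the identity:
   an Ad(G)-invariant inner product on the Lie algebra of G. Only the values of
   m on that Lie algebra matter. *)
Record biinvariant_metric G m : Prop := BiinvariantMetric {
  metric_linear : forall (c : R) X Y Z, lie_of G X -> lie_of G Y ->
    lie_of G Z -> m (c *: X + Y) Z = c * m X Z + m Y Z;
  metric_sym : forall X Y, lie_of G X -> lie_of G Y -> m X Y = m Y X;
  metric_pos : forall X, lie_of G X -> X != 0 -> 0 < m X X;
  metric_Ad : forall g X Y, G g -> lie_of G X -> lie_of G Y ->
    m (g \o X \o g^-1)%VF (g \o Y \o g^-1)%VF = m X Y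
}.

(* Elements of X^*(H). A character of H is extended by 1 outside H, so that
   Leibniz equality is equality of characters. The group law is written
   multiplicatively: the zero of X^*(H) is the constant 1. *)
Definition character H (chi : 'End(V) -> R[i]) : Prop :=
  [/\ (forall a, ~ H a -> chi a = 1),
      (forall a, H a -> `|chi a| = 1),
      (forall a b, H a -> H b -> chi (a \o b)%VF = chi a * chi b) &
      {within H, continuous (fun a => complex.Re (chi a))} /\
      {within H, continuous (fun a => complex.Im (chi a))}].

Definition char0 : 'End(V) -> R[i] := fun=> 1.

Definition char_opp (chi : 'End(V) -> R[i]) : 'End(V) -> R[i] :=
  fun a => (chi a)^-1.

Definition char_restr H (chi : 'End(V) -> R[i]) : 'End(V) -> R[i] :=
  patch char0 H chi.

(* The differential of chi at the identity is i times this real form. *)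
Definition char_diff (chi : 'End(V) -> R[i]) (X : 'End(V)) : R :=
  derive1 (fun t : R => complex.Im (chi (lfun_exp (t *: X)))) 0.

(* The vector of Lie(H) that represents the differential of chi *)
Definition char_vec m H (chi : 'End(V) -> R[i]) : 'End(V) :=
  xget 0 [set Y : 'End(V) | lie_of H Y /\
    forall X, lie_of H X -> m Y X = char_diff chi X].

Definition char_inner m H (chi psi : 'End(V) -> R[i]) : R :=
  m (char_vec m H chi) (char_vec m H psi).

Definition irreducible_roots m H (S : set ('End(V) -> R[i])) : Prop :=
  ~ exists S1 S2 : set ('End(V) -> R[i]),
    [/\ S1 !=set0, S2 !=set0, S1 `|` S2 = S, S1 `&` S2 = set0 &
        forall chi psi, S1 chi -> S2 psi -> char_inner m H chi psi = 0].

End LinearGroups.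

(* Here G = Aut(g0): its complexified Lie algebra Der(g0) (x) C is identified
   with the complexification of g0 through ad, on which Ad becomes the natural
   action of Aut(g0). *)

Section Roots.
Context {R : realType} {g0 : vectType R}.
Implicit Types (br : g0 -> g0 -> g0) (A : set 'End(g0)).

Definition weight_space A (chi : 'End(g0) -> R[i]) : set (cplx g0) :=
  [set Y : cplx g0 | forall a, A a -> cplx_act a Y = chi a *: Y].

Definition roots A : set ('End(g0) -> R[i]) :=
  [set alpha | [/\ character A alpha, alpha <> char0 &
                   weight_space A alpha <> [set 0]]].

Definition res_roots A : set ('End(g0) -> R[i]) :=
  [set char_restr (id_comp A) alpha | alpha in
    [set alpha | roots A alpha /\ char_restr (id_comp A) alpha <> char0]].

(* Sums of weight spaces for distinct characters are direct automatically, so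
   the sums below are taken as spans. *)
Definition res_root_space A (alpha' : 'End(g0) -> R[i]) : set (cplx g0) :=
  span_set (\bigcup_(alpha in [set alpha | roots A alpha /\
                                 char_restr (id_comp A) alpha = alpha'])
    weight_space A alpha).

Definition bracket_set br (U U' : set (cplx g0)) : set (cplx g0) :=
  span_set [set cplx_br br u v | u in U & v in U'].

Definition g_infty br A : set (cplx g0) :=
  sum_set
    (span_set (\bigcup_(alpha' in res_roots A) res_root_space A alpha'))
    (span_set (\bigcup_(alpha' in res_roots A)
       bracket_set br (res_root_space A alpha')
                      (res_root_space A (char_opp alpha')))).

Definition A_ideal br A (I : set (cplx g0)) : Prop :=
  [/\ subspace_set I,
      (forall u v, I v -> I (cplx_br br u v)) &
      (forall a v, A a -> I v -> I (cplx_act a v))].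

Definition A_simple br A : Prop :=
  ~ exists I : set (cplx g0),
    [/\ A_ideal br A I, I <> [set 0] & I <> [set: cplx g0]].

End Roots.

(* Main.v *)
(** Let a root [alpha] of [A] have weight vector [x + i y], and let [theta] be
    its differential. The derivation [ad [x, y]] commutes with [A], hence lies in
    the Lie algebra of [A] because [dim Z_G(A) = dim A]; biinvariance gives
    [m (ad [x, y], X) = - theta X * m (ad y, ad y)], so the vector representing
    [theta] is a negative multiple of [ad [x, y]]. It is nonzero when [alpha] is
    nontrivial on the identity component [A^0]: a character of [A] that is
    trivial on the one-parameter subgroups is trivial on [A^0] (closed subgroup
    theorem).
    If [R' = S1 + S2] is an orthogonal splitting, root spaces over [S1] commute
    with those over [S2], since a nonzero bracket would give a root
    [alpha + beta] orthogonal to neither summand; the centralizer of the root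
    spaces over [S2] is then a nonzero proper [A]-ideal, as [g = g_infty] is
    generated by root spaces.
    Conversely, let [I] be a nonzero proper [A]-ideal and [J] its orthogonal
    complement for the Hermitian form attached to the Killing form. Then
    [g = I + J], every weight space splits accordingly, and for a weight vector
    [x + i y] in [I] the element [[x, y]] of [I] kills [J]; so the roots occurring
    in [I] are orthogonal to those occurring in [J]. *)

From HB Require Import structures.
Require Import Defs.
From mathcomp Require Import all_boot all_order all_algebra.
From mathcomp Require Import all_classical all_reals all_analysis.
From mathcomp Require Import ring lra.

Set Implicit Arguments.
Unset Strict Implicit.
Unset Printing Implicit Defensive.

Import Order.TTheory GRing.Theory Num.Theory.
Import numFieldNormedType.Exports.
Import VectorInternalTheory.

Local Open Scope classical_set_scope.
Local Open Scope ring_scope.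

(** * The space of endomorphisms as a normed algebra *)

Lemma cvg_sumr {R : numFieldType} {W : normedModType R} (T I : Type)
    (F : set_system T) (FF : Filter F) (r : seq I) (u : I -> T -> W) (l : I -> W) :
  (forall i, u i @ F --> l i) ->
  (\sum_(i <- r) u i x) @[x --> F] --> \sum_(i <- r) l i.
Proof.
move=> ul; elim: r => [|i r IH].
  by rewrite big_nil; under eq_fun do rewrite big_nil; exact: cvg_cst.
by rewrite big_cons; under eq_fun do rewrite big_cons; exact: cvgD.
Qed.

Section LfunNorm.
Context {R : realType} {V : vectType R}.
Implicit Types (f g h : 'End(V)) (e : R).

(* The entrywise l^1 norm, chosen because it is submultiplicative. *)
Definition lfun_norm f : R := \sum_i \sum_j `|f2mx f i j|.

Lemma f2mx_inj : injective (@f2mx R V V).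
Proof. exact: val_inj. Qed.

Lemma mul_f2mx f (u : 'rV_(dim V)) : u *m f2mx f = v2r (f (r2v u)).
Proof. by rewrite [in RHS]unlock /= !r2vK. Qed.

Lemma f2mx_comp f g : f2mx (f \o g)%VF = f2mx g *m f2mx f.
Proof.
apply/row_matrixP => i; rewrite !rowE mulmxA !mul_f2mx comp_lfunE.
by rewrite v2rK.
Qed.

Lemma f2mx0 : f2mx (0 : 'End(V)) = 0.
Proof. by apply/row_matrixP => i; rewrite !rowE mulmx0 mul_f2mx zero_lfunE linear0. Qed.

Lemma f2mxD f g : f2mx (f + g) = f2mx f + f2mx g.
Proof.
by apply/row_matrixP => i; rewrite !rowE mulmxDr !mul_f2mx add_lfunE linearD.
Qed.

Lemma f2mxN f : f2mx (- f) = - f2mx f.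
Proof. by apply/row_matrixP => i; rewrite !rowE mulmxN !mul_f2mx opp_lfunE linearN. Qed.

Lemma f2mxZ c f : f2mx (c *: f) = c *: f2mx f.
Proof.
by apply/row_matrixP => i; rewrite !rowE -scalemxAr !mul_f2mx scale_lfunE linearZ.
Qed.

Lemma lfun_norm_ge0 f : 0 <= lfun_norm f.
Proof. by apply: sumr_ge0 => i _; apply: sumr_ge0. Qed.

Lemma lfun_norm_entry f i j : `|f2mx f i j| <= lfun_norm f.
Proof.
rewrite /lfun_norm (bigD1 i) //= (bigD1 j) //= -addrA lerDl addr_ge0 //.
  by apply: sumr_ge0.
by apply: sumr_ge0 => k _; apply: sumr_ge0.
Qed.

Lemma lfun_norm0_eq0 f : lfun_norm f = 0 -> f = 0.
Proof.
move=> f0; apply: f2mx_inj; rewrite f2mx0; apply/matrixP => i j.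
rewrite mxE; apply/eqP.
by rewrite -normr_le0 -f0 lfun_norm_entry.
Qed.

Lemma lfun_normZ c f : lfun_norm (c *: f) = `|c| * lfun_norm f.
Proof.
rewrite /lfun_norm mulr_sumr; apply: eq_bigr => i _.
rewrite mulr_sumr; apply: eq_bigr => j _; by rewrite f2mxZ mxE normrM.
Qed.

Lemma lfun_normN f : lfun_norm (- f) = lfun_norm f.
Proof. by rewrite -scaleN1r lfun_normZ normrN1 mul1r. Qed.

Lemma lfun_normD f g : lfun_norm (f + g) <= lfun_norm f + lfun_norm g.
Proof.
rewrite /lfun_norm -big_split ler_sum // => i _; rewrite -big_split ler_sum // => j _.
by rewrite f2mxD mxE ler_normD.
Qed.

Lemma lfun_normB f g : lfun_norm (f - g) = lfun_norm (g - f).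
Proof. by rewrite -lfun_normN opprB. Qed.

Lemma lfun_norm_comp f g : lfun_norm (f \o g)%VF <= lfun_norm f * lfun_norm g.
Proof.
rewrite [leRHS]mulrC /lfun_norm mulr_suml ler_sum // => i _.
apply: (@le_trans _ _ (\sum_j \sum_k `|f2mx g i k| * `|f2mx f k j|)).
  apply: ler_sum => j _; rewrite f2mx_comp mxE.
  by apply: le_trans (ler_norm_sum _ _ _) _; apply: ler_sum => k _; rewrite normrM.
rewrite exchange_big mulr_suml ler_sum // => k _ /=.
rewrite -mulr_sumr ler_wpM2l //.
by rewrite [leRHS](bigD1 k) //= lerDl; apply: sumr_ge0 => l _; apply: sumr_ge0.
Qed.

(** Neighbourhoods are pulled back from entrywise balls of matrices. The l^1 norm dominates each
    entry and is at most the number of entries times the largest one, so it defines the same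
    topology. *)
Lemma nbhs_lfunP f (P : set 'End(V)) :
  nbhs f P <-> exists2 e, 0 < e & forall g, lfun_norm (g - f) < e -> P g.
Proof.
split.
- move=> /nbhs_ballP[e /= e0 eP]; exists e => // g ge; apply: eP.
  rewrite -initial_ballE; split => // i j.
  rewrite /ball /= distrC; apply: le_lt_trans ge.
  by have := lfun_norm_entry (g - f) i j; rewrite f2mxD f2mxN !mxE.
- move=> [e e0 eP]; apply/nbhs_ballP.
  pose n := (dim V * dim V)%:R : R.
  (* The [+ 1] keeps the radius positive when [dim V] is 0 and makes the final inequality strict. *)
  exists (e / (n + 1)) => /=; first by rewrite divr_gt0 // ltr_wpDl // ler0n.
  move=> g; rewrite -initial_ballE => -[_ Hg]; apply: eP.
  apply: (@le_lt_trans _ _ (n * (e / (n + 1)))); last first.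
    rewrite mulrCA gtr_pMr // ltr_pdivrMr ?mul1r ?ltrDl //.
    by rewrite ltr_wpDl // ler0n.
  have -> : n * (e / (n + 1)) = \sum_(i < dim V) \sum_(j < dim V) (e / (n + 1)).
    by rewrite !sumr_const !card_ord -mulrnA mulr_natl.
  apply: ler_sum => i _; apply: ler_sum => j _.
  by have := Hg i j; rewrite /ball /= f2mxD f2mxN !mxE distrC => /ltW.
Qed.

Lemma lfun_hausdorff : hausdorff_space 'End(V).
Proof.
move=> f g fg; apply/eqP; rewrite -subr_eq0; apply/eqP/lfun_norm0_eq0.
apply/eqP; rewrite eq_le lfun_norm_ge0 andbT; apply/ler_addgt0Pr => e e0.
have e2 : 0 < e / 2 by rewrite divr_gt0.
have [] := fg [set h | lfun_norm (h - f) < e / 2] [set h | lfun_norm (h - g) < e / 2].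
- by apply/nbhs_lfunP; exists (e / 2).
- by apply/nbhs_lfunP; exists (e / 2).
move=> h [/= hf hg]; rewrite add0r.
have -> : f - g = (f - h) + (h - g) by rewrite subrKA.
apply: le_trans (lfun_normD _ _) _; rewrite [leRHS](splitr e).
apply: lerD; apply: ltW; last exact: hg.
by rewrite lfun_normB; exact: hf.
Qed.

Lemma lfun_entry_continuous i j : continuous (fun f => f2mx f i j : R).
Proof.
move=> f; have FF : Filter (nbhs f) by exact: nbhs_filter.
apply/cvgrPdist_lt => e e0; apply/nbhs_lfunP; exists e => // g ge.
rewrite distrC; apply: le_lt_trans ge.
by have := lfun_norm_entry (g - f) i j; rewrite f2mxD f2mxN !mxE.
Qed.

Lemma cvg_lfunP (T : Type) (F : set_system T) (FF : Filter F) (u : T -> 'End(V)) f :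
  (forall i j, (fun x => f2mx (u x) i j : R) @ F --> (f2mx f i j : R)) -> u @ F --> f.
Proof.
move=> H P /nbhs_lfunP[e e0 eP].
have : lfun_norm (u x - f) @[x --> F] --> 0.
  rewrite (_ : 0 = \sum_i \sum_j `|f2mx f i j - f2mx f i j|); last first.
    by rewrite big1 // => i _; rewrite big1 // => j _; rewrite subrr normr0.
  rewrite /lfun_norm; apply: cvg_sumr => i; apply: cvg_sumr => j.
  under eq_fun do rewrite f2mxD f2mxN !mxE.
  by apply: cvg_norm; apply: cvgB => //; exact: cvg_cst.
move=> /cvgrPdist_lt /(_ e e0); apply: filterS => x /= xe; apply: eP.
by move: xe; rewrite sub0r normrN ger0_norm ?lfun_norm_ge0.
Qed.

End LfunNorm.

(** * Curves and the exponential *)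

Section CurveDerivative.
Context {R : realType}.

(** The derivative of a curve, tested against linear functionals. In finite dimension this is the
    usual derivative, and it reduces every rule to real calculus. *)
Definition vderiv {V : vectType R} (F : R -> V) (t : R) (dF : V) : Prop :=
  forall l : {scalar V}, is_derive t 1 (fun s => l (F s) : R) (l dF).

Context {V W : vectType R}.

Lemma vderiv_linear (L : {linear V -> W}) (F : R -> V) t dF :
  vderiv F t dF -> vderiv (L \o F) t (L dF).
Proof. by move=> FdF l; exact: (FdF (l \o L : {scalar V})). Qed.

Lemma vderiv_cst (v : V) t : vderiv (fun=> v) t 0.
Proof. by move=> l; rewrite linear0; exact: is_derive_cst. Qed.

Lemma vderivD (F G : R -> V) t dF dG :
  vderiv F t dF -> vderiv G t dG -> vderiv (fun s => F s + G s) t (dF + dG).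
Proof.
move=> FdF GdG l; rewrite linearD; under eq_fun do rewrite linearD.
exact: is_deriveD (FdF l) (GdG l).
Qed.

Lemma coord_basisE (v : V) : v = \sum_i v2r v 0 i *: r2v (delta_mx 0 i).
Proof.
rewrite -[LHS]v2rK [in LHS](row_sum_delta (v2r v)) linear_sum.
by apply: eq_bigr => i _; rewrite linearZ.
Qed.

Definition vcoord (i : 'I_(dim V)) (v : V) : R := v2r v 0 i.

Fact vcoord_is_scalar i : scalar (vcoord i).
Proof. by move=> c u v; rewrite /vcoord linearP !mxE. Qed.
HB.instance Definition _ i := GRing.isLinear.Build R V R *%R (vcoord i) (vcoord_is_scalar i).

Lemma vderiv0_cst (F : R -> V) s t : (forall u, vderiv F u 0) -> F s = F t.
Proof.
move=> F0; apply: v2r_inj; apply/rowP => i.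
apply: (is_derive_0_is_cst (f := fun s => v2r (F s) 0 i)) => u.
by have := F0 u (vcoord i); rewrite linear0.
Qed.

Lemma vderiv_unique (F : R -> V) t d1 d2 : vderiv F t d1 -> vderiv F t d2 -> d1 = d2.
Proof.
move=> F1 F2; apply: v2r_inj; apply/rowP => i.
have H1 := F1 (vcoord i); have H2 := F2 (vcoord i).
by rewrite -[LHS](@derive_val _ _ _ _ _ _ _ H1) -[RHS](@derive_val _ _ _ _ _ _ _ H2).
Qed.

End CurveDerivative.

Lemma is_derive_sumE {R : realType} n (h : 'I_n -> R -> R) (t : R) (dh : 'I_n -> R) :
  (forall i, is_derive t 1 (h i) (dh i)) ->
  is_derive t 1 (fun s => \sum_i h i s) (\sum_i dh i).
Proof.
move=> H; have := is_derive_sum H; congr is_derive.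
by apply/funext => s; rewrite fct_sumE.
Qed.

(** Expansion in coordinates reduces the product rule and the continuity of bilinear forms to finite
    sums of products of real functions. *)
Lemma bilinear_formE {R : realType} {V W : vectType R} (b : V -> W -> R) x y :
  (forall y, scalar (b^~ y)) -> (forall x, scalar (b x)) ->
  b x y = \sum_i \sum_j vcoord i x * (vcoord j y *
    b (r2v (delta_mx 0 i)) (r2v (delta_mx 0 j))).
Proof.
move=> bl br.
pose b1 y : {scalar V} := HB.pack (b^~ y) (GRing.isLinear.Build _ _ _ _ (b^~ y) (bl y)).
pose b2 x : {scalar W} := HB.pack (b x) (GRing.isLinear.Build _ _ _ _ (b x) (br x)).
rewrite {1}[x]coord_basisE -[b _ y]/(b1 y _) linear_sum; apply: eq_bigr => i _.
rewrite !linearZ /= -mulr_sumr; congr (_ * _).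
rewrite {1}[y]coord_basisE -[b _ _]/(b2 _ _) linear_sum; apply: eq_bigr => j _.
by rewrite !linearZ.
Qed.

Lemma is_derive_form {R : realType} {V W : vectType R} (b : V -> W -> R)
    (F : R -> V) (G : R -> W) t dF dG :
  (forall y, scalar (b^~ y)) -> (forall x, scalar (b x)) ->
  vderiv F t dF -> vderiv G t dG ->
  is_derive t 1 (fun s => b (F s) (G s)) (b dF (G t) + b (F t) dG).
Proof.
move=> bl br FdF GdG.
have bE x y := @bilinear_formE _ _ _ b x y bl br.
under eq_fun do rewrite bE.
rewrite !bE -big_split; apply: is_derive_sumE => i /=.
rewrite -big_split; apply: is_derive_sumE => j /=.
have H1 := FdF (vcoord i); have H2 := GdG (vcoord j).
set c := b _ _.
have -> : (fun s => vcoord i (F s) * (vcoord j (G s) * c)) =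
   c \*: ((fun s => vcoord i (F s)) * (fun s => vcoord j (G s))).
  by apply/funext => s /=; rewrite mulrA mulrC.
have H := is_deriveZ c (is_deriveM H1 H2).
apply: (is_derive_eq H).
by rewrite /GRing.scale /=; ring.
Qed.

Lemma vderiv_bilinear {R : realType} {V W U : vectType R} (b : V -> W -> U)
    (F : R -> V) (G : R -> W) t dF dG :
  (forall y, linear (b^~ y)) -> (forall x, linear (b x)) ->
  vderiv F t dF -> vderiv G t dG ->
  vderiv (fun s => b (F s) (G s)) t (b dF (G t) + b (F t) dG).
Proof.
move=> bl br FdF GdG l; rewrite linearD.
apply: (@is_derive_form _ _ _ (fun x y => l (b x y))) => //.
  by move=> y c u v; rewrite bl linearP.
by move=> x c u v; rewrite br linearP.
Qed.

(** * Power series dominated by an exponential series *)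

Section ExpSeries.
Context {R : realType}.

Lemma is_cvg_pseries_exp (a : R^nat) (C M : R) :
  (forall k, `|a k| <= C * (M ^+ k / k`!%:R)) -> forall x, cvgn (pseries a x).
Proof.
move=> aM x; apply: normed_cvg; rewrite /pseries.
apply: (@series_le_cvg _ _ (fun k => C * exp_coeff (M * `|x|) k)).
- by move=> n; exact: normr_ge0.
- move=> n; have -> : C * exp_coeff (M * `|x|) n = C * (M ^+ n / n`!%:R) * `|x| ^+ n.
    by rewrite /exp_coeff /= exprMn; ring.
  by rewrite mulr_ge0 // (le_trans _ (aM n)).
- move=> n /=; rewrite normrM normrX.
  have -> : C * exp_coeff (M * `|x|) n = C * (M ^+ n / n`!%:R) * `|x| ^+ n.
    by rewrite /exp_coeff /= exprMn; ring.
  by rewrite ler_wpM2r // exprn_ge0.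
- exact: (is_cvg_seriesZ (k := C) (@is_cvg_series_exp_coeff R (M * `|x|))).
Qed.

(** Since (k + 1) / (k + 1)! = 1 / k!, the bound survives formal differentiation with [C * M] in
    place of [C], and so it can be iterated. *)
Lemma pseries_diffs_exp_bound (a : R^nat) (C M : R) :
  (forall k, `|a k| <= C * (M ^+ k / k`!%:R)) ->
  forall k, `|pseries_diffs a k| <= C * M * (M ^+ k / k`!%:R).
Proof.
move=> aM k; rewrite /pseries_diffs normrM ger0_norm //.
apply: le_trans (ler_wpM2l _ (aM k.+1)) _ => //.
rewrite factS natrM exprS invfM le_eqVlt; apply/orP; left; apply/eqP.
have : (k.+1%:R : R) != 0 by rewrite pnatr_eq0.
have : (k`!%:R : R) != 0 by rewrite pnatr_eq0 -lt0n fact_gt0.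
by move=> f0 k0; field; rewrite f0 addrC natr1 k0.
Qed.

Lemma is_derive_pseries_exp (a : R^nat) (C M : R) :
  (forall k, `|a k| <= C * (M ^+ k / k`!%:R)) -> forall x : R,
  is_derive x 1 (fun x => limn (pseries a x)) (limn (pseries (pseries_diffs a) x)).
Proof.
move=> aM x; have bM := pseries_diffs_exp_bound aM.
(* Termwise differentiation asks for convergence of the series and of its first two formal
   derivatives at a point of modulus larger than that of [x]. *)
apply: (@pseries_snd_diffs _ _ (`|x| + 1)).
- exact: is_cvg_pseries_exp aM _.
- exact: is_cvg_pseries_exp bM _.
- exact: is_cvg_pseries_exp (pseries_diffs_exp_bound bM) _.
- by rewrite [ltRHS]ger0_norm ?ltrDl // addr_ge0.
Qed.

End ExpSeries.

(** * The exponential of an endomorphism and its derivative *)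

Section LfunExp.
Context {R : realType} {V : vectType R}.
Implicit Types (X Y : 'End(V)) (s t : R).

Definition lfun_pow X k := iter k (comp_lfun X) \1%VF.

(** The coefficient of t^k in the (i, j) entry of exp (t X). *)
Let coef X i j k : R := f2mx (lfun_pow X k) i j / k`!%:R.

Lemma lfun_powS X k : lfun_pow X k.+1 = (X \o lfun_pow X k)%VF.
Proof. by []. Qed.

Lemma lfun_powZ t X k : lfun_pow (t *: X) k = t ^+ k *: lfun_pow X k.
Proof.
elim: k => [|k IH]; first by rewrite expr0 scale1r.
by rewrite /= IH -comp_lfunZl -comp_lfunZr scalerA exprS.
Qed.

Lemma lfun_norm_pow X k :
  lfun_norm (lfun_pow X k) <= lfun_norm (\1%VF : 'End(V)) * lfun_norm X ^+ k.
Proof.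
elim: k => [|k IH]; first by rewrite expr0 mulr1.
apply: le_trans (lfun_norm_comp _ _) _.
by rewrite exprS mulrCA ler_wpM2l // lfun_norm_ge0.
Qed.

Let coef_bound X i j k :
  `|coef X i j k| <= lfun_norm (\1%VF : 'End(V)) * (lfun_norm X ^+ k / k`!%:R).
Proof.
rewrite /coef normrM normfV normr_nat mulrA ler_wpM2r ?invr_ge0 //.
exact: le_trans (lfun_norm_entry _ _ _) (lfun_norm_pow _ _).
Qed.

Let cvg_coef X i j t : cvgn (pseries (coef X i j) t).
Proof. exact: is_cvg_pseries_exp (coef_bound X i j) _. Qed.

Let f2mx_exp X t i j : f2mx (lfun_exp (t *: X)) i j = limn (pseries (coef X i j) t).
Proof.
rewrite /lfun_exp.
rewrite (@cvg_lim _ _ _ _ _ _ (Hom (\matrix_(i, j) limn (pseries (coef X i j) t)))).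
- by rewrite /= mxE.
- exact: lfun_hausdorff.
apply: cvg_lfunP => k l; rewrite mxE.
have -> : (fun n => f2mx (series
    (fun n : nat => n`!%:R^-1 *: iter n (comp_lfun (t *: X)) \1%VF) n) k l : R) =
    pseries (coef X k l) t; last exact: cvg_coef.
apply/funext => n; rewrite /pseries /series /=.
elim/big_ind2: _ => [|x1 x2 y1 y2 <- <-|m _].
- by rewrite f2mx0 mxE.
- by rewrite f2mxD mxE.
- by rewrite -/(lfun_pow _ _) lfun_powZ scalerA f2mxZ mxE /coef; ring.
Qed.

Lemma lfun_scalarE (l : {scalar 'End(V)}) (f : 'End(V)) :
  l f = \sum_i \sum_j f2mx f i j * l (Hom (delta_mx i j)).
Proof.
have fE : f = \sum_i \sum_j f2mx f i j *: Hom (delta_mx i j).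
  apply: f2mx_inj; rewrite {1}[f2mx f]matrix_sum_delta.
  have f2mx_sum n (F : 'I_n -> 'End(V)) : f2mx (\sum_i F i) = \sum_i f2mx (F i).
    by elim/big_ind2: _ => [|x1 x2 y1 y2 <- <-|//]; rewrite ?f2mx0 ?f2mxD.
  rewrite f2mx_sum; apply: eq_bigr => i _; rewrite f2mx_sum; apply: eq_bigr => j _.
  by rewrite f2mxZ.
rewrite [in LHS]fE linear_sum; apply: eq_bigr => i _.
by rewrite linear_sum; apply: eq_bigr => j _; rewrite linearZ.
Qed.

Let vderiv_exp_entry X t (D : 'End(V)) :
  (forall i j, pseries (pseries_diffs (coef X i j)) t @ \oo --> (f2mx D i j : R)) ->
  vderiv (fun s => lfun_exp (s *: X)) t D.
Proof.
move=> XD l.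
have lE f := lfun_scalarE l f.
under eq_fun do rewrite lE.
rewrite lE; apply: is_derive_sumE => i; apply: is_derive_sumE => j.
set c := l _.
under eq_fun do rewrite f2mx_exp.
have H := is_deriveZ c (is_derive_pseries_exp (coef_bound X i j) t).
have -> : (fun x => limn (pseries (coef X i j) x) * c) =
    c \*: (fun x => limn (pseries (coef X i j) x)).
  by apply/funext => s; rewrite mulrC.
apply: (is_derive_eq H); rewrite [RHS]mulrC; congr (_ * _).
exact: cvg_lim (XD i j).
Qed.

Lemma lfun_powSr X k : lfun_pow X k.+1 = (lfun_pow X k \o X)%VF.
Proof.
elim: k => [|k IH]; first by rewrite /= comp_lfun1l comp_lfun1r.
by rewrite -[LHS]/(X \o lfun_pow X k.+1)%VF {1}IH comp_lfunA.
Qed.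

Lemma vderiv_exp X t :
  vderiv (fun s => lfun_exp (s *: X)) t (X \o lfun_exp (t *: X))%VF.
Proof.
apply: vderiv_exp_entry => i j.
rewrite f2mx_comp mxE; under eq_bigr do rewrite f2mx_exp.
have -> : pseries (pseries_diffs (coef X i j)) t =
    fun n => \sum_k pseries (coef X i k) t n * f2mx X k j.
  apply/funext => n; rewrite /pseries /series /=.
  under [RHS]eq_bigr do rewrite mulr_suml.
  rewrite exchange_big; apply: eq_bigr => m _.
  rewrite /pseries_diffs /coef /= -/(lfun_pow X m) f2mx_comp mxE factS natrM invfM.
  have : (m.+1%:R : R) != 0 by rewrite pnatr_eq0.
  by move=> m0; rewrite mulrCA mulVKf // !mulr_suml; apply: eq_bigr => k _; ring.
by apply: cvg_sumr => k; apply: cvgMr_tmp; exact: cvg_coef.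
Qed.

(** The computation of [vderiv_exp] with X^(k+1) read as X^k X. Comparing the two derivatives shows
    that [X] commutes with its exponentials. *)
Lemma vderiv_exp_r X t :
  vderiv (fun s => lfun_exp (s *: X)) t (lfun_exp (t *: X) \o X)%VF.
Proof.
apply: vderiv_exp_entry => i j.
rewrite f2mx_comp mxE; under eq_bigr do rewrite f2mx_exp.
have -> : pseries (pseries_diffs (coef X i j)) t =
    fun n => \sum_k f2mx X i k * pseries (coef X k j) t n.
  apply/funext => n; rewrite /pseries /series /=.
  under [RHS]eq_bigr do rewrite mulr_sumr.
  rewrite exchange_big; apply: eq_bigr => m _.
  rewrite /pseries_diffs /coef lfun_powSr f2mx_comp mxE factS natrM invfM.
  have : (m.+1%:R : R) != 0 by rewrite pnatr_eq0.
  by move=> m0; rewrite mulrCA mulVKf // !mulr_suml; apply: eq_bigr => k _; ring.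
by apply: cvg_sumr => k; apply: cvgMl_tmp; exact: cvg_coef.
Qed.

Lemma lfun_exp0 X : lfun_exp (0 *: X) = \1%VF.
Proof.
apply: f2mx_inj; apply/matrixP => i j; rewrite f2mx_exp.
apply: cvg_lim => //; rewrite -[X in _ --> X](_ : coef X i j 0 = _); last first.
  by rewrite /coef fact0 divr1.
(* The partial sum of length 0 is empty, so the partial sums are constant only from [n = 1] on. *)
apply: cvg_near_cst; near=> n.
have -> : n = n.-1.+1 by rewrite prednK //; near: n; exact: nbhs_infty_gt.
rewrite /pseries /series /= big_nat_recl // expr0 mulr1 big1 ?addr0 // => k _.
by rewrite expr0n mulr0.
Unshelve. all: by end_near.
Qed.

End LfunExp.

(** * Linear flows and the algebraic rules for the exponential *)

Section LfunExpTheory.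
Context {R : realType} {V : vectType R}.
Implicit Types (X Y a : 'End(V)) (s t : R).

Lemma vderiv_lfun_app (f : R -> 'End(V)) (F : R -> V) t df dF :
  vderiv f t df -> vderiv F t dF ->
  vderiv (fun s => f s (F s)) t (df (F t) + f t dF).
Proof.
apply: (@vderiv_bilinear _ _ _ _ (fun (f : 'End(V)) v => f v)).
  by move=> v c f1 f2; rewrite add_lfunE scale_lfunE.
by move=> g; exact: linearP.
Qed.

Lemma vderiv_lfun (f : 'End(V)) (F : R -> V) t dF :
  vderiv F t dF -> vderiv (fun s => f (F s)) t (f dF).
Proof. exact: (@vderiv_linear _ _ _ f). Qed.

Lemma vderiv_exp_app X t v :
  vderiv (fun s => lfun_exp (s *: X) v) t (X (lfun_exp (t *: X) v)).
Proof.
have := vderiv_lfun_app (vderiv_exp X t) (vderiv_cst v t).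
by rewrite linear0 addr0 comp_lfunE.
Qed.

Lemma lfun_exp_self X t v : X (lfun_exp (t *: X) v) = lfun_exp (t *: X) (X v).
Proof.
have /lfunP/(_ v) := vderiv_unique (vderiv_exp X t) (vderiv_exp_r X t).
by rewrite !comp_lfunE.
Qed.

(** Carrying a solution of F' = X F back along the flow gives a curve of derivative zero, as [X]
    commutes with its exponentials. *)
Let lfun_exp_flow X (F : R -> V) t :
  (forall s, vderiv F s (X (F s))) -> lfun_exp (t *: - X) (F t) = F 0.
Proof.
move=> FX; have -> : F 0 = lfun_exp (0 *: - X) (F 0) by rewrite lfun_exp0 id_lfunE.
apply: (vderiv0_cst (F := fun s => lfun_exp (s *: - X) (F s))) => s.
have := vderiv_lfun_app (vderiv_exp (- X) s) (FX s).
by rewrite comp_lfunE lfun_exp_self opp_lfunE linearN addNr.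
Qed.

Lemma lfun_expNK X v : lfun_exp (- X) (lfun_exp X v) = v.
Proof.
have := @lfun_exp_flow X (fun s => lfun_exp (s *: X) v) 1 (fun s => vderiv_exp_app X s v).
by rewrite !scale1r lfun_exp0 id_lfunE.
Qed.

Lemma lfun_expK X v : lfun_exp X (lfun_exp (- X) v) = v.
Proof. by rewrite -{1}[X]opprK lfun_expNK. Qed.

(** Uniqueness for F' = X F. The addition, commutation and automorphism rules below all follow by
    checking that two curves solve the same equation. *)
Lemma vderiv_flow_unique X (F : R -> V) t :
  (forall s, vderiv F s (X (F s))) -> F t = lfun_exp (t *: X) (F 0).
Proof. by move=> /(lfun_exp_flow t) <-; rewrite scalerN lfun_expK. Qed.

Lemma lker_exp X : lker (lfun_exp X) == 0%VS.
Proof. by apply/lker0P => u v uv; rewrite -[u](lfun_expNK X) uv lfun_expNK. Qed.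

Lemma lfun_exp_inv X : ((lfun_exp X)^-1 = lfun_exp (- X))%VF.
Proof.
apply/lfunP => v; rewrite -{1}[v](lfun_expK X).
by rewrite lker0_lfunK ?lker_exp.
Qed.

Lemma lfun_exp_commute a X t :
  (a \o X = X \o a)%VF -> (a \o lfun_exp (t *: X) = lfun_exp (t *: X) \o a)%VF.
Proof.
move=> aX; apply/lfunP => v; rewrite !comp_lfunE.
rewrite (@vderiv_flow_unique X (fun s => a (lfun_exp (s *: X) v))).
  by rewrite lfun_exp0 id_lfunE.
move=> s; have -> : X (a (lfun_exp (s *: X) v)) = a (X (lfun_exp (s *: X) v)).
  by rewrite -!comp_lfunE aX.
exact: vderiv_lfun (vderiv_exp_app _ _ _).
Qed.

Lemma commute_of_exp a X :
  (forall t, a \o lfun_exp (t *: X) = lfun_exp (t *: X) \o a)%VF -> (a \o X = X \o a)%VF.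
Proof.
move=> aX; apply/lfunP => v; rewrite !comp_lfunE.
have H1 := vderiv_lfun a (vderiv_exp_app X 0 v).
have H2 := vderiv_exp_app X 0 (a v).
rewrite lfun_exp0 !id_lfunE in H1 H2.
apply: vderiv_unique H1 _.
by under eq_fun do rewrite -comp_lfunE aX comp_lfunE.
Qed.

Lemma lfun_expD X Y : (X \o Y = Y \o X)%VF -> lfun_exp (X + Y) = (lfun_exp X \o lfun_exp Y)%VF.
Proof.
move=> XY; apply/lfunP => v; rewrite comp_lfunE.
have := @vderiv_flow_unique (X + Y) (fun s => lfun_exp (s *: X) (lfun_exp (s *: Y) v)) 1.
rewrite !scale1r !lfun_exp0 !id_lfunE => ->// s.
have := vderiv_lfun_app (vderiv_exp X s) (vderiv_exp_app Y s v).
have /lfunP/(_ (lfun_exp (s *: Y) v)) := lfun_exp_commute s (esym XY).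
by rewrite !comp_lfunE add_lfunE => ->.
Qed.

Lemma lfun_exp_addr s t X :
  lfun_exp ((s + t) *: X) = (lfun_exp (s *: X) \o lfun_exp (t *: X))%VF.
Proof. by rewrite scalerDl lfun_expD // -!comp_lfunZl -!comp_lfunZr !scalerA mulrC. Qed.

Lemma lfun_exp_continuous X : continuous (fun t => lfun_exp (t *: X)).
Proof.
move=> t; apply: cvg_lfunP => i j.
pose l (f : 'End(V)) : R := f2mx f i j.
have l_lin : scalar l by move=> c f g; rewrite /l f2mxD f2mxZ !mxE.
pose L : {scalar 'End(V)} := HB.pack l (GRing.isLinear.Build _ _ _ _ l l_lin).
have [D _] := vderiv_exp X t L.
exact/differentiable_continuous/derivable1_diffP.
Qed.

Definition lfun_derivation (b : V -> V -> V) X :=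
  forall x y, X (b x y) = b (X x) y + b x (X y).

Lemma lfun_exp_derivation (b : V -> V -> V) X t x y :
  (forall y, linear (b^~ y)) -> (forall x, linear (b x)) ->
  lfun_derivation b X ->
  lfun_exp (t *: X) (b x y) = b (lfun_exp (t *: X) x) (lfun_exp (t *: X) y).
Proof.
move=> bl br Xb.
have := @vderiv_flow_unique X (fun s => b (lfun_exp (s *: X) x) (lfun_exp (s *: X) y)) t.
rewrite !lfun_exp0 !id_lfunE => -> // s; rewrite Xb.
exact: vderiv_bilinear (vderiv_exp_app _ _ _) (vderiv_exp_app _ _ _).
Qed.

Lemma derivation_of_exp (b : V -> V -> V) X :
  (forall y, linear (b^~ y)) -> (forall x, linear (b x)) ->
  (forall t x y, lfun_exp (t *: X) (b x y) = b (lfun_exp (t *: X) x) (lfun_exp (t *: X) y)) ->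
  lfun_derivation b X.
Proof.
move=> bl br Xb x y.
have H1 := vderiv_exp_app X 0 (b x y).
have H2 := vderiv_bilinear bl br (vderiv_exp_app X 0 x) (vderiv_exp_app X 0 y).
rewrite lfun_exp0 !id_lfunE in H1 H2.
apply: vderiv_unique H1 _.
by under eq_fun do rewrite Xb.
Qed.

End LfunExpTheory.

(** * Continuity and compactness in spaces of endomorphisms *)

Section LfunCompact.
Context {R : realType} {V : vectType R}.
Implicit Types (f g a : 'End(V)).

Lemma lfun_ctsP (phi : 'End(V) -> R) :
  (forall f (e : R), 0 < e -> exists2 d : R, 0 < d &
    forall g, lfun_norm (g - f) < d -> `|phi g - phi f| < e) -> continuous phi.
Proof.
move=> H f; have FF : Filter (nbhs f) by exact: nbhs_filter.
apply/cvgrPdist_lt => e e0; have [d d0 dP] := H f e e0.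
by apply/nbhs_lfunP; exists d => // g /dP; rewrite distrC.
Qed.

Lemma ler_lfun_norm_dist f g : `|lfun_norm f - lfun_norm g| <= lfun_norm (f - g).
Proof.
have H f1 g1 : lfun_norm f1 - lfun_norm g1 <= lfun_norm (f1 - g1).
  by rewrite lerBlDr; have := lfun_normD (f1 - g1) g1; rewrite subrK.
by rewrite ler_norml lerNl opprB H lfun_normB H.
Qed.

Lemma lfun_norm_continuous : continuous (@lfun_norm R V).
Proof.
apply: lfun_ctsP => f e e0; exists e => // g; apply: le_lt_trans.
exact: ler_lfun_norm_dist.
Qed.

Lemma lfun_scalar_continuous (l : {scalar 'End(V)}) : continuous l.
Proof.
have lE f : l f = \sum_i \sum_j f2mx f i j * l (Hom (delta_mx i j)).
  exact: lfun_scalarE.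
have -> : (l : 'End(V) -> R) = fun f => \sum_i \sum_j f2mx f i j * l (Hom (delta_mx i j)).
  exact/funext.
move=> f; have FF : Filter (nbhs f) by exact: nbhs_filter.
apply: cvg_sumr => i; apply: cvg_sumr => j; apply: cvgMr_tmp.
exact: lfun_entry_continuous.
Qed.

Lemma lfun_app_scalar_continuous (l : {scalar V}) v :
  continuous (fun f : 'End(V) => l (f v) : R).
Proof.
have L_lin : scalar (fun f : 'End(V) => l (f v) : R).
  by move=> c f g; rewrite add_lfunE scale_lfunE linearP.
exact: (@lfun_scalar_continuous (HB.pack (fun f : 'End(V) => l (f v) : R)
  (GRing.isLinear.Build _ _ _ _ _ L_lin))).
Qed.

Lemma lfun_form_continuous (b : V -> V -> R) x y :
  (forall y, scalar (b^~ y)) -> (forall x, scalar (b x)) ->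
  continuous (fun f : 'End(V) => b (f x) (f y)).
Proof.
move=> bl br; have bE u v := @bilinear_formE _ _ _ b u v bl br.
under eq_fun do rewrite bE.
move=> f; have FF : Filter (nbhs f) by exact: nbhs_filter.
apply: cvg_sumr => i; apply: cvg_sumr => j.
apply: cvgM; first exact: (@lfun_app_scalar_continuous (vcoord i) x).
by apply: cvgMr_tmp; exact: (@lfun_app_scalar_continuous (vcoord j) y).
Qed.

Lemma closed_lfun_eq (phi : 'End(V) -> R) c :
  continuous phi -> closed [set f | phi f = c].
Proof.
move=> cphi; apply: (@preimage_closed _ _ phi [set c]).
  by move=> f _; exact: cphi.
exact: closed_eq.
Qed.

Lemma closed_lfun_app v w : closed [set f : 'End(V) | f v = w].
Proof.
have -> : [set f : 'End(V) | f v = w] =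
    \bigcap_(i in [set: 'I_(dim V)]) [set f | vcoord i (f v) = vcoord i w].
  apply/seteqP; split => [f /= fvw i _|f H]; first by rewrite /= fvw.
  by apply: v2r_inj; apply/rowP => i; exact: H.
apply: closed_bigI => i _; apply: closed_lfun_eq.
exact: (@lfun_app_scalar_continuous (vcoord i) v).
Qed.

(** Heine-Borel for row vectors, transported along the continuous reshaping of a row into a
    matrix. *)
Lemma lfun_compact (S : set 'End(V)) (M : R) :
  closed S -> (forall f, S f -> lfun_norm f <= M) -> compact S.
Proof.
move=> clS SM.
pose g (r : 'rV[R]_(dim V * dim V)) : 'End(V) := Hom (vec_mx r).
have cg : continuous g.
  move=> r; have FF : Filter (nbhs r) by exact: nbhs_filter.
  apply: cvg_lfunP => i j; rewrite /= mxE.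
  under eq_fun do rewrite mxE.
  exact: coord_continuous.
have -> : S = g @` (g @^-1` S).
  apply/seteqP; split => [f Sf|_ [r Sr <-]//].
  by exists (mxvec (f2mx f)); rewrite /g /= mxvecK; case: (f) Sf.
apply: continuous_compact; first exact: continuous_subspaceT.
apply: bounded_closed_compact; last first.
  by apply: preimage_closed => // r _; exact: cg.
exists M; split; first exact: num_real.
move=> x Mx r /SM Sr /=; rewrite [leLHS]/Num.norm /= mx_normrE.
have x0 : 0 <= x.
  by apply: ltW; apply: le_lt_trans Mx; apply: le_trans Sr; exact: lfun_norm_ge0.
apply: bigmax_le => // -[i k] _ /=.
rewrite (ord1 i); case/mxvec_indexP: k => i' j'.
apply: le_trans (ltW Mx); apply: le_trans Sr.
by have := lfun_norm_entry (g r) i' j'; rewrite /g /= mxE.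
Qed.

End LfunCompact.

(** * The closed subgroup theorem *)

Section ClosedSubgroup.
Context {R : realType} {V : vectType R}.
Implicit Types (A K : set 'End(V)) (Q a b : 'End(V)) (s t : R).

Lemma is_derive0_little (f : R -> R) (d eta : R) : is_derive (0 : R) (1 : R) f d -> 0 < eta ->
  exists2 delta : R, 0 < delta &
    forall s, `|s| < delta -> `|f s - f 0 - s * d| <= eta * `|s|.
Proof.
move=> [df fd] eta0.
have : h^-1 *: ((f \o shift 0) (h *: 1) - f 0) @[h --> 0^'] --> d.
  by rewrite -fd; exact: df.
move=> /cvgrPdist_le /(_ eta eta0) [delta /= delta0 H].
exists delta => // s sd; have [->|s0] := eqVneq s 0.
  by rewrite subrr mul0r subrr normr0 mulr0.
have := H s; rewrite /ball_ /= sub0r normrN => /(_ sd s0).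
rewrite addr0 [s *: 1]mulr1 => Hs.
have -> : f s - f 0 - s * d = - s * (d - s^-1 *: (f s - f 0)).
  by rewrite /GRing.scale /=; field.
by rewrite normrM normrN mulrC ler_wpM2r.
Qed.

(** The expansion exp (s Q) = 1 + s Q + o(s), obtained entry by entry; each entry gets the share
    [eta / (n + 1)] of the tolerance. *)
Lemma lfun_exp_little Q (eta : R) : 0 < eta -> exists2 delta : R, 0 < delta &
  forall s, `|s| < delta -> lfun_norm (lfun_exp (s *: Q) - \1%VF - s *: Q) <= eta * `|s|.
Proof.
move=> eta0; pose n := (dim V * dim V)%:R : R.
have n0 : 0 < n + 1 by rewrite ltr_wpDl // ler0n.
have H (ij : 'I_(dim V) * 'I_(dim V)) : exists delta : {posnum R},
    forall s, `|s| < delta%:num ->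
    `|f2mx (lfun_exp (s *: Q) - \1%VF - s *: Q) ij.1 ij.2| <= eta / (n + 1) * `|s|.
  pose l f : R := f2mx f ij.1 ij.2.
  have l_lin : scalar l by move=> c f g; rewrite /l f2mxD f2mxZ !mxE.
  pose L : {scalar 'End(V)} := HB.pack l (GRing.isLinear.Build _ _ _ _ l l_lin).
  have := is_derive0_little (vderiv_exp Q 0 L) (divr_gt0 eta0 n0).
  move=> [d d0 dP]; exists (PosNum d0) => s /dP.
  by rewrite lfun_exp0 comp_lfun1r !f2mxD !f2mxN f2mxZ !mxE.
have /choice[delta deltaP] := H.
(* The least of the finitely many radii; the value 1 serves when there are no entries. *)
exists (\big[Num.min/1%:pos]_ij delta ij)%:num => // s sd.
rewrite (_ : lfun_norm _ =
  \sum_ij `|f2mx (lfun_exp (s *: Q) - \1%VF - s *: Q) ij.1 ij.2|); last first.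
  by rewrite /lfun_norm pair_bigA.
apply: (@le_trans _ _ (\sum_(ij : 'I_(dim V) * 'I_(dim V)) (eta / (n + 1) * `|s|))).
  apply: ler_sum => ij _; apply: deltaP; apply: lt_le_trans sd _.
  by rewrite num_le; exact: bigmin_le.
rewrite sumr_const card_prod card_ord -mulr_natl -/n mulrA ler_wpM2r //.
by rewrite mulrCA ger_pMr // ler_pdivrMr // mul1r lerDl.
Qed.

Lemma lfun_pow_exp t Q k : lfun_pow (lfun_exp (t *: Q)) k = lfun_exp ((k%:R * t) *: Q).
Proof.
elim: k => [|k IH]; first by rewrite mul0r lfun_exp0.
by rewrite lfun_powS IH -lfun_exp_addr -natr1 mulrDl mul1r addrC.
Qed.

(** Telescope b^k - y^k into the terms b^i (b - y) y^(k-1-i), whose outer factors are uniformly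
    bounded. *)
Lemma lfun_pow_dist (M M' : R) b y k :
  (forall j, lfun_norm (lfun_pow b j) <= M) ->
  (forall j, (j <= k)%N -> lfun_norm (lfun_pow y j) <= M') ->
  lfun_norm (lfun_pow b k - lfun_pow y k) <= k%:R * (M * M' * lfun_norm (b - y)).
Proof.
move=> bM yM.
have M0 : 0 <= M by apply: le_trans (bM 0%N); exact: lfun_norm_ge0.
have M'0 : 0 <= M' by apply: le_trans (yM 0%N _); rewrite ?lfun_norm_ge0.
(* The trailing power of [y] makes the telescoping induction go through without a
   factor [lfun_norm y] at each step. *)
suff H j l : (j + l <= k)%N ->
    lfun_norm ((lfun_pow b j - lfun_pow y j) \o lfun_pow y l)%VF <=
      j%:R * (M * M' * lfun_norm (b - y)).
  by have := H k 0%N; rewrite addn0 comp_lfun1r; apply.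
elim: j l => [|j IH] l jl.
  rewrite subrr comp_lfun0l mul0r /lfun_norm f2mx0 big1 // => i _.
  by rewrite big1 // => i' _; rewrite mxE normr0.
have -> : ((lfun_pow b j.+1 - lfun_pow y j.+1) \o lfun_pow y l =
    (lfun_pow b j \o ((b - y) \o lfun_pow y l)) +
    ((lfun_pow b j - lfun_pow y j) \o lfun_pow y l.+1))%VF.
  apply/lfunP => v; rewrite (lfun_powSr b) (lfun_powSr y j) (lfun_powS y l).
  rewrite !(add_lfunE, comp_lfunE, opp_lfunE) linearB /=.
  by rewrite [RHS]addrA subrK.
apply: le_trans (lfun_normD _ _) _; rewrite -natr1 mulrDl mul1r addrC lerD //.
  by apply: IH; rewrite addnS.
apply: le_trans (lfun_norm_comp _ _) _.
rewrite -mulrA ler_pM ?lfun_norm_ge0 // mulrC.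
apply: le_trans (lfun_norm_comp _ _) _; rewrite ler_wpM2l ?lfun_norm_ge0 //.
by apply: yM; apply: leq_trans jl; rewrite addSn ltnW // ltnS leq_addl.
Qed.

End ClosedSubgroup.

Section ClosedSubgroupTheorem.
Context {R : realType} {V : vectType R}.
Implicit Types (A K : set 'End(V)) (Q a b : 'End(V)) (s t : R).

Lemma lfun_compact_bounded A : compact A ->
  exists2 M : R, 0 <= M & forall f, A f -> lfun_norm f <= M.
Proof.
move=> cA; have [A0|A0] := pselect (A !=set0); last first.
  by exists 0 => // f Af; case: A0; exists f.
have [f _ fM] := compact_EVT_max A0 cA (continuous_subspaceT (@lfun_norm_continuous R V)).
by exists (lfun_norm f) => [|g Ag]; [exact: lfun_norm_ge0|apply: fM; rewrite inE].
Qed.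

Lemma lfun_exp_bounded Q t : exists2 M : R, 0 <= M &
  forall s, 0 <= s <= t -> lfun_norm (lfun_exp (s *: Q)) <= M.
Proof.
have cA : compact ((fun s => lfun_exp (s *: Q)) @` `[0, t]).
  apply: continuous_compact; last exact: segment_compact.
  exact/continuous_subspaceT/lfun_exp_continuous.
have [M M0 MP] := lfun_compact_bounded cA.
by exists M => // s st; apply: MP; exists s => //=; rewrite in_itv.
Qed.

(* [exp (t Q)] is the limit of [b ^ k] for [b] near [1] in [A] with [b - 1] almost
   parallel to [Q] and [k = floor (t / |b - 1|)]. *)
Lemma exp_limit_mem A Q : compact A -> A \1%VF ->
  (forall a b, A a -> A b -> A (a \o b)%VF) ->
  (forall e : R, 0 < e -> exists b, [/\ A b, 0 < lfun_norm (b - \1%VF) < e &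
     lfun_norm ((lfun_norm (b - \1%VF))^-1 *: (b - \1%VF) - Q) < e]) ->
  forall t, 0 <= t -> A (lfun_exp (t *: Q)).
Proof.
move=> cA A1 AM AQ t t0.
have clA : closed A by apply: compact_closed => //; exact: lfun_hausdorff.
apply: clA => B /nbhs_lfunP[e e0 eB].
have [M M0 MP] := lfun_compact_bounded cA.
have [M' M'0 M'P] := lfun_exp_bounded Q t.
pose c := t * (M * M').
have c0 : 0 <= c by rewrite !mulr_ge0.
(* With this choice the accumulated error [2 * eta * c] equals [e / 2] times [c / (c + 1)]. *)
pose eta := e / (4 * (c + 1)).
have eta0 : 0 < eta by rewrite divr_gt0 // mulr_gt0 // ltr_wpDl.
have [d1 d10 d1P] := lfun_exp_little Q eta0.
have := @lfun_exp_continuous _ _ Q t [set g | lfun_norm (g - lfun_exp (t *: Q)) < e / 2].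
have e2 : 0 < e / 2 by rewrite divr_gt0.
case; first by apply/nbhs_lfunP; exists (e / 2).
move=> d2 /= d20 d2P.
have [|b [Ab /andP[s0 sd] uQ]] := AQ (Num.min eta (Num.min d1 d2)).
  by rewrite !lt_min eta0 d10 d20.
move: uQ sd; set s := lfun_norm _ in s0 * => uQ sd.
move: uQ sd; rewrite !lt_min => /andP[uQ _] /andP[_ /andP[sd1 sd2]].
have ts0 : 0 <= t / s by rewrite divr_ge0 // ltW.
have /andP[kle klt] := truncn_itv ts0.
move: kle klt; set k := Num.truncn _ => kle klt.
have kst : k%:R * s <= t by rewrite -ler_pdivlMr.
have tks : t - k%:R * s < s.
  by move: klt; rewrite ltr_pdivrMr // -natr1 mulrDl mul1r; lra.
exists (lfun_pow b k); split.
  elim: (k) => [|j IH]; first exact: A1.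
  by rewrite lfun_powS; exact: AM.
apply: eB.
(* Half of [e] pays for replacing [b] by exp (s Q) in the power; the other half, by continuity of
   the curve, for rounding [t] down to [k%:R * s]. *)
have -> : lfun_pow b k - lfun_exp (t *: Q) = (lfun_pow b k - lfun_pow (lfun_exp (s *: Q)) k)
    + (lfun_exp ((k%:R * s) *: Q) - lfun_exp (t *: Q)).
  by rewrite lfun_pow_exp addrA subrK.
apply: le_lt_trans (lfun_normD _ _) _; rewrite [ltRHS]splitr ler_ltD //; last first.
  apply: d2P; rewrite /ball /=; rewrite ger0_norm ?subr_ge0 //.
  exact: lt_trans tks sd2.
have by_le : lfun_norm (b - lfun_exp (s *: Q)) <= 2 * eta * s.
  have -> : b - lfun_exp (s *: Q) = s *: (s^-1 *: (b - \1%VF) - Q) -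
     (lfun_exp (s *: Q) - \1%VF - s *: Q).
    rewrite scalerBr scalerA mulfV ?gt_eqF // scale1r.
    by rewrite opprB addrA subrK opprB addrA subrK.
  apply: le_trans (lfun_normD _ _) _; rewrite lfun_normN lfun_normZ (ger0_norm (ltW s0)).
  have := d1P s; rewrite (ger0_norm (ltW s0)) => /(_ sd1).
  have : s * lfun_norm (s^-1 *: (b - \1%VF) - Q) <= s * eta by rewrite ler_wpM2l // ltW.
  by lra.
apply: le_trans (@lfun_pow_dist _ _ M M' _ _ _ _ _) _.
- move=> j; apply: MP; elim: j => [|j IH]; first exact: A1.
  by rewrite lfun_powS; exact: AM.
- move=> j jk; rewrite lfun_pow_exp; apply: M'P.
  rewrite mulr_ge0 ?(ltW s0) //= (le_trans _ kst) // ler_wpM2r // ?(ltW s0) //.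
  by rewrite ler_nat.
apply: (@le_trans _ _ (k%:R * (M * M' * (2 * eta * s)))).
  by rewrite ler_wpM2l // ler_wpM2l // mulr_ge0.
have -> : k%:R * (M * M' * (2 * eta * s)) = (M * M' * (2 * eta)) * (k%:R * s) by ring.
apply: (@le_trans _ _ (M * M' * (2 * eta) * t)).
  apply: ler_wpM2l => //; apply: mulr_ge0; first exact: mulr_ge0.
  by apply: mulr_ge0 => //; exact: ltW.
have -> : M * M' * (2 * eta) * t = (e / 2) * (c / (c + 1)).
  by rewrite /eta /c; field; rewrite gt_eqF //= -/c ltr_wpDl.
by rewrite ler_piMr ?ltW // ltr_pdivrMr ?mul1r ?ltrDl // ltr_wpDl.
Qed.

End ClosedSubgroupTheorem.

(** * Closed subgroups containing all one-parameter subgroups *)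

Section IdentityComponent.
Context {R : realType} {V : vectType R}.
Variables (A K : set 'End(V)).
Implicit Types (Q a b : 'End(V)) (s t : R).
Hypotheses (cA : compact A) (clK : closed K) (KA : K `<=` A).
Hypotheses (A_lker : forall a, A a -> lker a == 0%VS).
Hypotheses (AM : forall a b, A a -> A b -> A (a \o b)%VF).
Hypotheses (AV : forall a, A a -> A (a^-1)%VF).
Hypotheses (K1 : K \1%VF) (KM : forall a b, K a -> K b -> K (a \o b)%VF).
Hypotheses (KV : forall a, K a -> K (a^-1)%VF).
Hypothesis (expK : forall X, lie_of A X -> K (lfun_exp X)).

(** The coset of [a] modulo the compact [K] has an element nearest to 1. Its distance is positive,
    since [a \o e0 = 1] would put [a] in [K]. *)
Let minimal_rep a : A a -> ~ K a ->
  exists b, [/\ A b, 0 < lfun_norm (b - \1%VF) <= lfun_norm (a - \1%VF) &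
    forall e, K e -> lfun_norm (b - \1%VF) <= lfun_norm ((b \o e)%VF - \1%VF)].
Proof.
move=> Aa nKa; have cK : compact K by exact: subclosed_compact clK cA KA.
pose phi (e : 'End(V)) := lfun_norm ((a \o e)%VF - \1%VF).
have cphi : continuous phi.
  apply: lfun_ctsP => f e e0; exists (e / (lfun_norm a + 1)).
    by rewrite divr_gt0 // ltr_wpDl // lfun_norm_ge0.
  move=> g gf; apply: le_lt_trans (ler_lfun_norm_dist _ _) _.
  have -> : (a \o g)%VF - \1%VF - ((a \o f)%VF - \1%VF) = (a \o (g - f))%VF.
    by rewrite opprB addrA subrK comp_lfunDr comp_lfunNr.
  apply: le_lt_trans (lfun_norm_comp _ _) _.
  have a0 := lfun_norm_ge0 a; have a1 : 0 < lfun_norm a + 1 by rewrite ltr_wpDl.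
  apply: (@le_lt_trans _ _ ((lfun_norm a) * (e / (lfun_norm a + 1)))).
    by rewrite ler_wpM2l // ltW.
  by rewrite mulrCA gtr_pMr // ltr_pdivrMr // mul1r ltrDl.
have K0 : K !=set0 by exists \1%VF.
have [e0] := compact_EVT_min K0 cK (continuous_subspaceT cphi).
rewrite inE => Ke0 e0min; exists (a \o e0)%VF; split.
- by apply: AM => //; exact: KA.
- apply/andP; split; last first.
    by have := e0min \1%VF; rewrite inE /phi comp_lfun1r; apply.
  rewrite lt_neqAle lfun_norm_ge0 andbT eq_sym; apply/eqP => /lfun_norm0_eq0.
  move=> /eqP; rewrite subr_eq0 => /eqP ae0; apply: nKa.
  suff -> : a = (e0^-1)%VF by exact: KV.
  have k0 := A_lker (KA Ke0).
  apply/lfunP => v; have /lfunP/(_ ((e0^-1)%VF v)) := ae0.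
  rewrite comp_lfunE id_lfunE => <-; congr (fun_of_lfun a _).
  by have /lfunP/(_ v) := lker0_compfV k0; rewrite comp_lfunE id_lfunE.
- move=> e Ke; rewrite -comp_lfunA; apply: e0min; rewrite inE; exact: KM.
Qed.

(* Otherwise there are elements [b] of [A] outside [K], arbitrarily near [1] and nearest
   to [1] in their coset [b K]. The directions of [b - 1] accumulate at some [Q] in the
   Lie algebra of [A], and [b (exp (- |b - 1| Q))] is nearer to [1] than [b]. *)
Lemma closed_subgroup_near1 : exists2 e : R, 0 < e &
  forall a, A a -> lfun_norm (a - \1%VF) < e -> K a.
Proof.
apply: contrapT => noe.
have H (e : R) : 0 < e -> exists b, [/\ A b, 0 < lfun_norm (b - \1%VF) < e &
    forall e, K e -> lfun_norm (b - \1%VF) <= lfun_norm ((b \o e)%VF - \1%VF)].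
  move=> e0; have : exists a, [/\ A a, lfun_norm (a - \1%VF) < e & ~ K a].
    apply: contrapT => noa; apply: noe; exists e => // a Aa ae.
    by apply: contrapT => nKa; apply: noa; exists a.
  move=> [a [Aa ae nKa]]; have [b [Ab /andP[b0 ba] bmin]] := minimal_rep Aa nKa.
  by exists b; split => //; rewrite b0 (le_lt_trans ba).
have /choice[b bP] : forall n : nat, exists b, [/\ A b,
    0 < lfun_norm (b - \1%VF) < n.+1%:R^-1 &
    forall e, K e -> lfun_norm (b - \1%VF) <= lfun_norm ((b \o e)%VF - \1%VF)].
  by move=> n; apply: H; rewrite invr_gt0.
pose u n := (lfun_norm (b n - \1%VF))^-1 *: (b n - \1%VF).
have cS : compact [set f : 'End(V) | lfun_norm f = 1].
  by apply: (@lfun_compact _ _ _ 1) => [|f /= ->//]; exact/closed_lfun_eq/lfun_norm_continuous.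
have uS n : lfun_norm (u n) = 1.
  have [_ /andP[b0 _] _] := bP n.
  by rewrite lfun_normZ normfV ger0_norm ?ltW // mulVf // gt_eqF.
have FS : (u @ \oo) [set f : 'End(V) | lfun_norm f = 1].
  by exists 0%N => // n _; exact: uS.
have [Q [/= Q1 uQ]] := cS (u @ \oo) _ FS.
have {}uQ (e : R) : 0 < e -> exists c, [/\ A c, 0 < lfun_norm (c - \1%VF) < e,
    lfun_norm ((lfun_norm (c - \1%VF))^-1 *: (c - \1%VF) - Q) < e &
    forall e, K e -> lfun_norm (c - \1%VF) <= lfun_norm ((c \o e)%VF - \1%VF)].
  move=> e0.
  (* A cluster point meets every tail of the sequence, so a single index makes [b n - 1] small and
     its direction close to [Q]. *)
  have [] := uQ (u @` [set n | n.+1%:R^-1 < e]) [set g | lfun_norm (g - Q) < e].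
  - have : \forall n \near \oo, n.+1%:R^-1 < e by exact: near_infty_natSinv_lt (PosNum e0).
    by apply: filterS => n ne; exists n.
  - by apply/nbhs_lfunP; exists e.
  move=> _ [[n /= ne <-] ue]; exists (b n); have [Ab /andP[b0 bn] bmin] := bP n.
  by split => //; rewrite b0 (lt_trans bn).
have A1 : A \1%VF by exact: KA.
have expA t : 0 <= t -> A (lfun_exp (t *: Q)).
  apply: exp_limit_mem => // e e0; have [c [? ? ? _]] := uQ e e0.
  by exists c.
have lieQ : lie_of A Q.
  move=> t; have [t0|t0] := leP 0 t; first exact: expA.
  rewrite -[t]opprK scaleNr -lfun_exp_inv; apply: AV; apply: expA.
  by rewrite oppr_ge0 ltW.
have expKQ t : K (lfun_exp (t *: Q)).
  by apply: expK => s; rewrite scalerA; exact: lieQ.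
(* With the threshold 1/8, the three terms in the expansion of c exp (- s Q) - 1 are at most s/8,
   s/8 and s/2, so their sum is less than s. *)
have e8 : 0 < 8^-1 :> R by rewrite invr_gt0.
have [d d0 dP] := lfun_exp_little Q e8.
have [|c [Ac]] := uQ (Num.min 8^-1 d); first by rewrite lt_min e8 d0.
set s := lfun_norm (c - \1%VF); rewrite !lt_min => /andP[s0 /andP[s8 sd]] /andP[uc _] cmin.
have := cmin _ (expKQ (- s)); apply/negP; rewrite -ltNge.
pose r := lfun_exp ((- s) *: Q) - \1%VF - (- s) *: Q.
pose w := s^-1 *: (c - \1%VF).
have rs : lfun_norm r <= 8^-1 * s.
  by have := dP (- s); rewrite normrN ger0_norm ?(ltW s0) //; apply.
have -> : (c \o lfun_exp ((- s) *: Q))%VF - \1%VF =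
    s *: (w - Q) + r + (s *: (w \o (r - s *: Q))%VF).
  have cE : c = \1%VF + s *: w by rewrite /w scalerA mulfV ?gt_eqF // scale1r addrC subrK.
  have eE : lfun_exp ((- s) *: Q) = \1%VF + (r - s *: Q).
    by rewrite /r scaleNr opprK addrK addrC subrK.
  rewrite eE {1}cE comp_lfunDl comp_lfun1l -comp_lfunZl comp_lfunDr comp_lfun1r.
  rewrite scalerDr addrAC [\1%VF + _]addrC addrK addrA [r - _ + _]addrC.
  by congr (_ + _); rewrite scalerBr addrA addrAC.
have w1 : lfun_norm w = 1.
  by rewrite lfun_normZ normfV ger0_norm ?lfun_norm_ge0 // mulVf // gt_eqF.
apply: le_lt_trans (lfun_normD _ _) _; rewrite lfun_normZ (ger0_norm (ltW s0)).
have h1 := lfun_normD (s *: (w - Q)) r.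
rewrite lfun_normZ (ger0_norm (ltW s0)) in h1.
have h2 := lfun_norm_comp w (r - s *: Q); rewrite w1 mul1r in h2.
have h3 := lfun_normD r (- (s *: Q)).
rewrite lfun_normN lfun_normZ (ger0_norm (ltW s0)) Q1 mulr1 in h3.
have h4 : s * lfun_norm (w - Q) <= s * 8^-1 by rewrite ler_wpM2l ?ltW.
have h5 : s * lfun_norm (w \o (r - s *: Q))%VF <= s * 2^-1.
  by rewrite ler_wpM2l ?(ltW s0) // (le_trans h2) // (le_trans h3) //; lra.
by lra.
Qed.

(** [K] contains a neighbourhood of 1 in [A], hence by translation is open in [A]. Being also
    closed, it contains every connected subset of [A] through 1. *)
Lemma id_comp_sub : id_comp A `<=` K.
Proof.
have [e e0 eP] := closed_subgroup_near1.
move=> f [C [C1 CA Cc] Cf].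
suff /seteqP[_ /(_ f Cf)[]//] : C `&` K = C.
apply: Cc; first by exists \1%VF.
- exists (interior [set g | A g -> K g]); first exact: open_interior.
  apply/seteqP; split => g [Cg]; last first.
    by move=> /interior_subset /= /(_ (CA _ Cg)).
  move=> Kg; split => //; rewrite /interior /=; apply/nbhs_lfunP.
  have Kg' := KV Kg; have k0 := A_lker (KA Kg).
  have ng0 := lfun_norm_ge0 (g^-1)%VF.
  have ng1 : 0 < lfun_norm (g^-1)%VF + 1 by rewrite ltr_wpDl.
  exists (e / (lfun_norm (g^-1)%VF + 1)); first by rewrite divr_gt0.
  move=> h hg Ah.
  have -> : h = (g \o ((g^-1) \o h))%VF by rewrite comp_lfunA lker0_compfV // comp_lfun1l.
  apply: KM => //; apply: eP; first by apply: AM => //; exact: KA.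
  have -> : ((g^-1) \o h)%VF - \1%VF = (g^-1 \o (h - g))%VF.
    by rewrite comp_lfunDr comp_lfunNr lker0_compVf.
  apply: le_lt_trans (lfun_norm_comp _ _) _.
  apply: (@le_lt_trans _ _ (lfun_norm (g^-1)%VF * (e / (lfun_norm (g^-1)%VF + 1)))).
    by rewrite ler_wpM2l // ltW.
  by rewrite mulrCA gtr_pMr // ltr_pdivrMr // mul1r ltrDl.
- by exists K.
Qed.

End IdentityComponent.

(** * Subspaces, inner products and orthogonal complements *)

Section LinearAlgebra.

(** Take a [vspace] inside [S] of the largest dimension: a vector of [S] outside it would span a
    larger one. *)
Lemma subspace_vspace {K : fieldType} {W : vectType K} (S : set W) :
  subspace_set S -> exists U : {vspace W}, [set u | u \in U] = S.
Proof.
move=> [S0 SP].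
have SZD c u v : S u -> S v -> S (c *: u + v) by exact: SP.
pose P d := `[< exists U : {vspace W}, [set u | u \in U] `<=` S /\ \dim U = d >].
have P0 : exists d, P d.
  exists 0%N; apply/asboolP; exists 0%VS; split; last exact: dimv0.
  by move=> u /=; rewrite memv0 => /eqP ->.
have Pmax d : P d -> (d <= \dim {:W})%N.
  by move=> /asboolP[U [_ <-]]; exact: dimvS (subvf U).
have [d /asboolP[U [US dU]] dmax] := ex_maxnP P0 Pmax.
exists U; apply/seteqP; split => // s Ss; apply: contrapT => /negP /= sU.
have : P (\dim (U + <[s]>)%VS).
  apply/asboolP; exists (U + <[s]>)%VS; split => // _ /memv_addP[u uU [_ /vlineP[k ->] ->]].
  by rewrite addrC; apply: SZD => //; exact: US.
move=> /dmax; rewrite -dU => dle.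
have /eqP UE : (U == U + <[s]>)%VS by rewrite eqEdim addvSl.
by move/negP: sU; apply; rewrite UE; apply: subvP (addvSr U <[s]>) _ (memv_line s).
Qed.

Lemma dim_set_vspace {K : fieldType} {W : vectType K} (U : {vspace W}) :
  dim_set [set u | u \in U] = \dim U.
Proof.
rewrite /dim_set; case: xgetP => [U' _ /= UU'|/(_ U)]; last by case.
congr (\dim _); apply/vspaceP => u; apply/idP/idP => uU.
  by have : [set u | u \in U] u by rewrite -UU'.
by have : [set u | u \in U'] u by rewrite UU'.
Qed.

Lemma subspace_dim_eq {K : fieldType} {W : vectType K} (S T : set W) :
  subspace_set S -> subspace_set T -> S `<=` T -> dim_set S = dim_set T -> S = T.
Proof.
move=> /subspace_vspace[U <-] /subspace_vspace[U' <-] UU'.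
rewrite !dim_set_vspace => dUU'; have /eqP -> // : (U == U')%VS.
by rewrite eqEdim dUU' leqnn andbT; apply/subvP.
Qed.

Lemma lfun_trC {R : realType} {W : vectType R} (f g : 'End(W)) :
  \tr (f2mx (f \o g)%VF) = \tr (f2mx (g \o f)%VF).
Proof. by rewrite !f2mx_comp mxtrace_mulC. Qed.

Record inner_product {R : realFieldType} {W : vectType R} (B : W -> W -> R) : Prop :=
  InnerProduct {
    inner_linear : forall y, scalar (B^~ y);
    inner_sym : forall x y, B x y = B y x;
    inner_pos : forall x, x != 0 -> 0 < B x x
  }.

Lemma inner_linear_r {R : realFieldType} {W : vectType R} (B : W -> W -> R) x :
  inner_product B -> scalar (B x).
Proof. by move=> [Bl Bs _] c u v; rewrite !(Bs x) Bl. Qed.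

Lemma inner_eq0 {R : realFieldType} {W : vectType R} (B : W -> W -> R) x :
  inner_product B -> B x x = 0 -> x = 0.
Proof.
move=> [_ _ Bp] Bx; apply/eqP; apply: contraT => /Bp; by rewrite Bx ltxx.
Qed.

(** Pairing with a basis of [U] is injective on [U] because [B] is definite, hence onto by
    dimension. *)
Lemma riesz {R : realFieldType} {W : vectType R} (B : W -> W -> R) (U : {vspace W})
    (l : W -> R) : inner_product B -> scalar l ->
  exists2 u, u \in U & forall v, v \in U -> B u v = l v.
Proof.
move=> HB l_lin; have [Bl Bs Bp] := HB.
pose T (w : W) : 'rV[R]_(\dim U) := \row_j B w (vbasis U)`_j.
have T_lin : linear T by move=> c u v; apply/rowP => j; rewrite !mxE Bl.
pose TL : {linear W -> 'rV[R]_(\dim U)} := HB.pack T (GRing.isLinear.Build _ _ _ _ T T_lin).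
have span_eq (f g : W -> R) : scalar f -> scalar g ->
    (forall j : 'I_(\dim U), f (vbasis U)`_j = g (vbasis U)`_j) ->
    forall v, v \in U -> f v = g v.
  move=> f_lin g_lin fg v /coord_vbasis ->.
  pose F : {scalar W} := HB.pack f (GRing.isLinear.Build _ _ _ _ f f_lin).
  pose G : {scalar W} := HB.pack g (GRing.isLinear.Build _ _ _ _ g g_lin).
  rewrite -[f _]/(F _) -[g _]/(G _) !linear_sum; apply: eq_bigr => j _.
  by rewrite !linearZ /= fg.
have ker0 : (U :&: lker (linfun TL) = 0)%VS.
  apply/eqP; rewrite -subv0; apply/subvP => u; rewrite memv_cap memv_ker lfunE memv0.
  move=> /andP[uU /eqP Tu]; apply/eqP; apply: (inner_eq0 HB).
  apply: (span_eq (B u) (fun=> 0)) => //; first exact: inner_linear_r.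
    by move=> c x y; rewrite mulr0 addr0.
  by move=> j; have /rowP/(_ j) := Tu; rewrite !mxE.
have /eqP full : (linfun TL @: U == fullv)%VS.
  by rewrite eqEdim subvf limg_dim_eq // dimvf /dim /= mul1n.
have : \row_j l (vbasis U)`_j \in (linfun TL @: U)%VS by rewrite full memvf.
move=> /memv_imgP[u uU]; rewrite lfunE => Tu; exists u => //.
apply: span_eq => //; first exact: inner_linear_r.
by move=> j; have /rowP/(_ j) := Tu; rewrite !mxE.
Qed.

(** The component in [S] is the Riesz representative on [S] of the functional [B w]. *)
Lemma orthogonal_decomposition {R : realFieldType} {W : vectType R}
    (B : W -> W -> R) (S : set W) w : inner_product B -> subspace_set S ->
  exists u v, [/\ S u, forall s, S s -> B s v = 0 & w = u + v].
Proof.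
move=> HB /subspace_vspace[U <-].
have [u uU uw] := riesz U HB (inner_linear_r w HB).
exists u, (w - u); split => //; last by rewrite addrC subrK.
move=> s /= sU; have [Bl Bs _] := HB.
rewrite Bs -scaleN1r addrC Bl mulN1r uw // Bs addrC Bs subrr //.
Qed.

End LinearAlgebra.

(** * The Killing form and the automorphism group *)

Section KillingForm.
Context {R : realType} {g0 : vectType R} (br : g0 -> g0 -> g0).
Hypothesis br_lie : is_lie_bracket br.
Implicit Types (x y z : g0) (f X : 'End(g0)).

Let brl := lie_linearl br_lie.
Let brr := lie_linearr br_lie.

Lemma brDl x y z : br (x + y) z = br x z + br y z.
Proof. by have := brl z 1 x y; rewrite !scale1r. Qed.
Lemma brDr x y z : br z (x + y) = br z x + br z y.
Proof. by have := brr z 1 x y; rewrite !scale1r. Qed.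
Lemma br0l z : br 0 z = 0.
Proof. by apply: (addrI (br 0 z)); rewrite -brDl !addr0. Qed.
Lemma br0r z : br z 0 = 0.
Proof. by apply: (addrI (br z 0)); rewrite -brDr !addr0. Qed.
Lemma brZl c x z : br (c *: x) z = c *: br x z.
Proof. by have := brl z c x 0; rewrite br0l !addr0. Qed.
Lemma brZr c x z : br z (c *: x) = c *: br z x.
Proof. by have := brr z c x 0; rewrite br0r !addr0. Qed.
Lemma brNl x z : br (- x) z = - br x z.
Proof. by rewrite -scaleN1r brZl scaleN1r. Qed.
Lemma brNr x z : br z (- x) = - br z x.
Proof. by rewrite -scaleN1r brZr scaleN1r. Qed.
Lemma brBl x y z : br (x - y) z = br x z - br y z.
Proof. by rewrite brDl brNl. Qed.
Lemma brC x y : br x y = - br y x.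
Proof.
apply/eqP; rewrite -addr_eq0; apply/eqP.
have := lie_alternating br_lie (x + y).
by rewrite brDl !brDr !(lie_alternating br_lie) add0r addr0.
Qed.

Lemma adE x y : ad br x y = br x y.
Proof.
pose brx : {linear g0 -> g0} :=
  HB.pack (br x) (GRing.isLinear.Build _ _ _ _ (br x) (brr x)).
by rewrite /ad (lfunE brx).
Qed.

Lemma br_jacobi x y z : br (br x y) z = br x (br y z) - br y (br x z).
Proof.
have := lie_jacobi br_lie x y z; rewrite (brC z (br x y)) (brC z x) brNr.
by move/eqP; rewrite subr_eq0 => /eqP ->.
Qed.

Lemma ad_derivation x : lfun_derivation br (ad br x).
Proof. by move=> y z; rewrite !adE br_jacobi subrK. Qed.

Lemma ad_is_linear : linear (ad br).
Proof. by move=> c x y; apply/lfunP => z; rewrite add_lfunE scale_lfunE !adE brDl brZl. Qed.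

Lemma killing_linear y : scalar (killing br ^~ y).
Proof.
move=> c x z; rewrite /killing ad_is_linear comp_lfunDl -comp_lfunZl.
by rewrite f2mxD f2mxZ mxtraceD mxtraceZ.
Qed.

Lemma killing_sym x y : killing br x y = killing br y x.
Proof. exact: lfun_trC. Qed.

Lemma ad0 : ad br 0 = 0.
Proof. by apply/lfunP => y; rewrite adE br0l zero_lfunE. Qed.

Lemma killing0l x : killing br 0 x = 0.
Proof. by rewrite /killing ad0 comp_lfun0l f2mx0 mxtrace0. Qed.

Lemma ad_br x y : ad br (br x y) = ((ad br x \o ad br y) - (ad br y \o ad br x))%VF.
Proof. by apply/lfunP => z; rewrite add_lfunE opp_lfunE !comp_lfunE !adE br_jacobi. Qed.

(** Write [ad] of a bracket as a commutator and use cyclicity of the trace. *)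
Lemma killing_invariant x y z : killing br (br z x) y = - killing br x (br z y).
Proof.
rewrite /killing !ad_br comp_lfunDl comp_lfunNl comp_lfunDr comp_lfunNr.
rewrite !f2mxD !f2mxN !mxtraceD !raddfN /= opprD opprK addrC -!comp_lfunA.
by congr (_ + _); rewrite lfun_trC -comp_lfunA.
Qed.

Lemma ad_aut f x : lie_aut br f -> (ad br (f x) \o f = f \o ad br x)%VF.
Proof. by move=> [_ fbr]; apply/lfunP => y; rewrite !comp_lfunE !adE fbr. Qed.

Lemma ad_autV f x : lie_aut br f -> ad br (f x) = (f \o (ad br x \o f^-1))%VF.
Proof.
move=> af; rewrite comp_lfunA -(ad_aut x af) -comp_lfunA.
by rewrite lker0_compfV ?comp_lfun1r //; case: af.
Qed.

Lemma killing_aut f x y : lie_aut br f -> killing br (f x) (f y) = killing br x y.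
Proof.
move=> af; rewrite /killing !ad_autV // lfun_trC; have [f0 _] := af.
rewrite -!comp_lfunA (comp_lfunA (f^-1)%VF) lker0_compVf // comp_lfun1l.
by rewrite lfun_trC -!comp_lfunA lker0_compVf // comp_lfun1r lfun_trC.
Qed.

Hypothesis br_compact : compact_semisimple br.

Lemma killing_inner : inner_product (fun x y => - killing br x y).
Proof.
split => [y c u v|x y|x /br_compact]; last by rewrite oppr_gt0.
  by rewrite killing_linear opprD mulrN.
by rewrite killing_sym.
Qed.

Lemma center0 x : (forall y, br x y = 0) -> x = 0.
Proof.
move=> x0; apply: (inner_eq0 killing_inner); rewrite /killing.
have -> : ad br x = 0 by apply/lfunP => y; rewrite adE x0 zero_lfunE.
by rewrite comp_lfun0l f2mx0 mxtrace0 oppr0.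
Qed.

Lemma ad_inj x : ad br x = 0 -> x = 0.
Proof. by move=> x0; apply: center0 => y; rewrite -adE x0 zero_lfunE. Qed.

(* Matrix entries of an automorphism are values of the form [- killing], which it
   preserves; they are bounded by the Cauchy-Schwarz inequality. *)
Lemma lie_aut_bounded : exists M : R, forall f, lie_aut br f -> lfun_norm f <= M.
Proof.
pose B x y := - killing br x y.
have rep (j : 'I_(dim g0)) : exists w, forall v, B w v = vcoord j v.
  have [w _ wP] := riesz fullv killing_inner (@linearP _ _ _ _ (vcoord j)).
  by exists w => v; apply: wP; exact: memvf.
have [w wP] := choice rep.
pose e i : g0 := r2v (delta_mx 0 i).
exists (\sum_i \sum_j (B (w j) (w j) + B (e i) (e i))) => f af.
apply: ler_sum => i _; apply: ler_sum => j _.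
have -> : f2mx f i j = B (w j) (f (e i)).
  by rewrite wP /vcoord /e -mul_f2mx -rowE mxE.
have [Bl Bs Bp] := killing_inner.
have B0 x : 0 <= B x x.
  by have [->|/Bp /ltW //] := eqVneq x 0; rewrite /B killing0l oppr0.
have <- : B (f (e i)) (f (e i)) = B (e i) (e i) by rewrite /B killing_aut.
move: (w j) (f (e i)) => u v.
have Bl1 c x y z : B (c *: x + y) z = c * B x z + B y z by exact: Bl.
have BsE x y : B x y = B y x by exact: Bs.
(* Positivity on [u + v] and [v - u] bounds 2 |B u v| by [B u u + B v v]. *)
have h1 := B0 (1 *: u + v); have h2 := B0 ((-1) *: u + v).
rewrite !(Bl1, BsE _ (_ *: u + v)) (BsE v u) in h1 h2.
have := B0 u; have := B0 v; rewrite ler_norml => v0 u0; apply/andP; split; lra.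
Qed.

Lemma lie_aut_closed : closed (lie_aut br).
Proof.
(* Invariance of the Killing form is a closed condition which, unlike
   [lker f == 0], makes a limit of automorphisms visibly injective. *)
pose P := \bigcap_(xyk in [set: g0 * g0 * 'I_(dim g0)])
  [set f : 'End(g0) | vcoord xyk.2 (f (br xyk.1.1 xyk.1.2)) -
                      vcoord xyk.2 (br (f xyk.1.1) (f xyk.1.2)) = 0].
pose Q := \bigcap_(xy in [set: g0 * g0])
  [set f : 'End(g0) | killing br (f xy.1) (f xy.2) = killing br xy.1 xy.2].
have -> : lie_aut br = P `&` Q.
  apply/seteqP; split => [f af|f [Pf Qf]].
    split; first by move=> [[x y] k] _ /=; case: af => _ ->; rewrite subrr.
    by move=> [x y] _ /=; exact: killing_aut.
  split; last first.
    move=> x y; apply: v2r_inj; apply/rowP => k.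
    by apply/eqP; rewrite -subr_eq0; apply/eqP; exact: (Pf (x, y, k)).
  rewrite -subv0; apply/subvP => x; rewrite memv_ker memv0 => /eqP fx.
  apply/eqP/(inner_eq0 killing_inner); rewrite -(Qf (x, x)) //= fx.
  by rewrite killing0l oppr0.
have brl' y : linear (br^~ y) by exact: brl.
apply: closedI; apply: closed_bigI => i _.
- apply: closed_lfun_eq => f; have FF : Filter (nbhs f) by exact: nbhs_filter.
  apply: cvgB; first exact: (@lfun_app_scalar_continuous _ _ (vcoord i.2)).
  apply: (@lfun_form_continuous _ _ (fun x y => vcoord i.2 (br x y))).
    by move=> y c u v; rewrite brl linearP.
  by move=> x c u v; rewrite brr linearP.
- apply: closed_lfun_eq; apply: lfun_form_continuous.
    exact: killing_linear.
  by move=> x c u v; rewrite !(killing_sym x) killing_linear.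
Qed.

(** A set closed relative to the automorphism group is its intersection with a closed set, and that
    group is itself closed and bounded. *)
Lemma lie_aut_compact A : A `<=` lie_aut br -> closed (A : set (subspace (lie_aut br))) ->
  compact A.
Proof.
move=> AG /closed_subspaceP[C cC CA]; have [M MP] := lie_aut_bounded.
have -> : A = C `&` lie_aut br by rewrite CA; apply/esym/setIidPl.
apply: (@lfun_compact _ _ _ M); last by move=> f [_ /MP].
exact: closedI cC lie_aut_closed.
Qed.

End KillingForm.

(** * Lie algebras, weights and the vectors representing roots *)

Section LieOfGroups.
Context {R : realType} {g0 : vectType R} (br : g0 -> g0 -> g0).
Hypothesis br_lie : is_lie_bracket br.
Implicit Types (x y z w : g0) (f X Y : 'End(g0)) (A : set 'End(g0)).

Let brl := lie_linearl br_lie.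
Let brr := lie_linearr br_lie.

(** Differentiating the automorphism identity at 0 gives the Leibniz rule; conversely the Leibniz
    rule integrates by uniqueness of the flow. *)
Lemma lie_of_aut : lie_of (lie_aut br) = [set X | lfun_derivation br X].
Proof.
apply/seteqP; split => X /= HX.
  by apply: derivation_of_exp => // t x y; case: (HX t).
move=> t; split; first exact: lker_exp.
by move=> x y; exact: lfun_exp_derivation.
Qed.

Lemma derivation_subspace : subspace_set [set X | lfun_derivation br X].
Proof.
split => [x y|c X Y HX HY x y] /=.
  by rewrite !zero_lfunE (br0l br_lie) (br0r br_lie) addr0.
rewrite !add_lfunE !scale_lfunE HX HY scalerDr.
by rewrite (brDl br_lie) (brDr br_lie) (brZl br_lie) (brZr br_lie) addrACA.
Qed.

Lemma lie_of_centralizer A : lie_of (centralizer (lie_aut br) A) =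
  [set X | lfun_derivation br X /\ forall a, A a -> (X \o a = a \o X)%VF].
Proof.
apply/seteqP; split => X /= HX.
  split.
    have : lie_of (lie_aut br) X by move=> t; case: (HX t).
    by rewrite lie_of_aut.
  move=> a Aa; apply/esym/commute_of_exp => t.
  by have [_ ->] := HX t.
have [dX XA] := HX; move=> t; split.
  by have : lie_of (lie_aut br) X; [rewrite lie_of_aut|apply].
by move=> a Aa; apply/esym/lfun_exp_commute/esym/XA.
Qed.

Lemma commuting_derivation_subspace A :
  subspace_set [set X | lfun_derivation br X /\ forall a, A a -> (X \o a = a \o X)%VF].
Proof.
have [d0 dP] := derivation_subspace; split.
  by split => // a _; rewrite comp_lfun0l comp_lfun0r.
move=> c X Y [dX XA] [dY YA]; split; first exact: dP.
move=> a Aa; rewrite comp_lfunDl comp_lfunDr -comp_lfunZl -comp_lfunZr.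
by rewrite XA // YA.
Qed.

Variable A : set 'End(g0).
Hypothesis A_star : star_subgroup (lie_aut br) A.

Lemma lie_of_commute X a : lie_of A X -> A a -> (X \o a = a \o X)%VF.
Proof.
have [_ _ AC _] := A_star.
by move=> AX Aa; apply/esym/commute_of_exp => t; exact: AC.
Qed.

(** As [A] is abelian, elements of its Lie algebra commute, so the exponential of a sum is a product
    of exponentials. *)
Lemma lie_of_subspace : subspace_set (lie_of A).
Proof.
have [[_ A1 AM AV] _ AC _] := A_star.
split; first by move=> t; rewrite scaler0 -(scale0r 0) lfun_exp0.
move=> c X Y AX AY t; rewrite scalerDr scalerA lfun_expD; first exact: AM.
have XY : (X \o Y = Y \o X)%VF by apply: commute_of_exp => s; exact: lie_of_commute.
by rewrite -!comp_lfunZl -!comp_lfunZr XY !scalerA [X in X *: _]mulrC.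
Qed.

(** Here the equality of dimensions enters: the Lie algebra of [A] is contained in that of its
    centralizer, so the two coincide. *)
Lemma star_lie_of : lie_of A =
  [set X | lfun_derivation br X /\ forall a, A a -> (X \o a = a \o X)%VF].
Proof.
have [[AG _ _ _] _ _ dimE] := A_star.
apply: subspace_dim_eq.
- exact: lie_of_subspace.
- exact: commuting_derivation_subspace.
- move=> X AX; split; last by move=> a; exact: lie_of_commute.
  have : lie_of (lie_aut br) X by move=> t; exact: AG.
  by rewrite lie_of_aut.
- by rewrite -lie_of_centralizer; exact/esym.
Qed.

Lemma id_comp_exp X t : lie_of A X -> id_comp A (lfun_exp (t *: X)).
Proof.
move=> AX; exists ((fun s => lfun_exp (s *: X)) @` [set: R]); last by exists t.
split.
- by exists 0 => //; exact: lfun_exp0.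
- by move=> _ [s _ <-]; exact: AX.
apply: connected_continuous_connected.
  by apply/connected_intervalP.
exact/continuous_subspaceT/lfun_exp_continuous.
Qed.

Lemma lie_of_id_comp : lie_of (id_comp A) = lie_of A.
Proof.
apply/seteqP; split => X HX t; last exact: id_comp_exp.
exact: connected_component_sub (HX t).
Qed.

End LieOfGroups.

(** * Differentials of weights *)

Section Weights.
Context {R : realType} {g0 : vectType R} (br : g0 -> g0 -> g0).
Hypothesis br_lie : is_lie_bracket br.
Hypothesis br_compact : compact_semisimple br.
Variable A : set 'End(g0).
Hypothesis A_star : star_subgroup (lie_aut br) A.
Implicit Types (x y z w : g0) (X : 'End(g0)) (chi : 'End(g0) -> R[i]).

Local Notation Re := complex.Re.
Local Notation Im := complex.Im.

Lemma vderivZ {V : vectType R} (q : R -> R) (y : V) (t dq : R) :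
  is_derive t (1 : R) q dq -> vderiv (fun s => q s *: y) t (dq *: y).
Proof.
move=> qdq l; rewrite linearZ /= mulrC.
have -> : (fun s => l (q s *: y)) = l y \*: q.
  by apply/funext => s; rewrite linearZ /= mulrC.
exact: is_deriveZ.
Qed.

(** The Killing form is constant along the automorphisms exp (t X); differentiate at 0. *)
Lemma killing_derivation X x y : lfun_derivation br X ->
  killing br (X x) y = - killing br x (X y).
Proof.
move=> dX; have := lie_of_aut br_lie; move=> /seteqP[_ /(_ X dX) autX].
have bl := killing_linear br_lie.
have brr u : scalar (killing br u).
  by move=> c v w; rewrite !(killing_sym br u) bl.
have := is_derive_form bl brr (vderiv_exp_app X 0 x) (vderiv_exp_app X 0 y).
rewrite lfun_exp0 !id_lfunE => -[_ D].
have D0 : 'D_1 (fun s : R => killing br (lfun_exp (s *: X) x) (lfun_exp (s *: X) y)) 0 = 0.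
  under eq_fun do rewrite (killing_aut br_lie _ _ (autX _)).
  exact: derive_cst.
by rewrite D0 in D; apply/eqP; rewrite -addr_eq0 -D.
Qed.

Lemma weight_spaceP chi x y : weight_space A chi (x, y) <-> forall a, A a ->
  a x = Re (chi a) *: x - Im (chi a) *: y /\ a y = Re (chi a) *: y + Im (chi a) *: x.
Proof.
split=> H a Aa; first by have [-> ->] := H a Aa.
by have [ax ay] := H a Aa; rewrite /cplx_act /= ax ay.
Qed.

(** The weight equation differentiated along exp (t X): [X] acts on x + i y as i times
    [char_diff chi X]. The real part of [chi] contributes nothing, because [X] is skew for the
    Killing form. *)
Lemma derive_weight chi x y X : weight_space A chi (x, y) -> (x, y) != 0 ->
  lie_of A X ->
  [/\ is_derive (0 : R) (1 : R) (fun t => Im (chi (lfun_exp (t *: X)))) (char_diff chi X),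
    X x = - char_diff chi X *: y & X y = char_diff chi X *: x].
Proof.
move=> /weight_spaceP W xy0 AX.
pose N := - killing br x x - killing br y y.
have [Bl Bs Bp] := killing_inner br_lie br_compact.
have N0 : N != 0.
  rewrite gt_eqF // /N; move: xy0; rewrite -pair_eqE /= negb_and.
  have B0 z : 0 <= - killing br z z.
    by have [->|/Bp /ltW //] := eqVneq z 0; rewrite (killing0l br_lie) oppr0.
  move=> /orP[/Bp x0|/Bp y0]; first by rewrite ltr_wpDr.
  by rewrite ltr_wpDl.
have dX : lfun_derivation br X.
  by move: AX; rewrite (star_lie_of br_lie A_star) => -[].
have bl := killing_linear br_lie.
have brr u : scalar (killing br u).
  by move=> c v w; rewrite !(killing_sym br u) bl.
have killBl u v w : killing br (u - v) w = killing br u w - killing br v w.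
  by rewrite -scaleN1r addrC bl mulN1r addrC.
have killDl u v w : killing br (u + v) w = killing br u w + killing br v w.
  by rewrite -[u]scale1r bl mul1r scale1r.
have killZl c v w : killing br (c *: v) w = c * killing br v w.
  by rewrite -[_ *: v]addr0 bl (killing0l br_lie) addr0.
pose E t := lfun_exp (t *: X).
(* The Killing form recovers [chi] along the curve from the vectors [E t x] and [E t y],
   hence its differentiability. *)
have pE t : Re (chi (E t)) = N^-1 * (- killing br (E t x) x - killing br (E t y) y).
  have [-> ->] := W _ (AX t).
  rewrite killBl killDl !killZl (killing_sym br y x) /N.
  by rewrite -[LHS]mul1r -(mulVf N0) -mulrA /N; congr (_ * _); ring.
have qE t : Im (chi (E t)) = N^-1 * (killing br (E t x) y - killing br (E t y) x).
  have [-> ->] := W _ (AX t).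
  rewrite killBl killDl !killZl (killing_sym br y x) /N.
  by rewrite -[LHS]mul1r -(mulVf N0) -mulrA /N; congr (_ * _); ring.
have dk u v : is_derive (0 : R) (1 : R) (fun t => killing br (E t u) v) (killing br (X u) v).
  have := is_derive_form bl brr (vderiv_exp_app X 0 u) (vderiv_cst v 0).
  by rewrite lfun_exp0 !id_lfunE (killing_sym br _ 0) (killing0l br_lie) addr0.
have kXx z : killing br (X z) z = 0.
  apply/eqP; rewrite -[_ == 0](mulrn_eq0 _ 2) mulr2n {1}killing_derivation //.
  by rewrite (killing_sym br z) addNr.
have dp : is_derive (0 : R) (1 : R) (fun t => Re (chi (E t))) 0.
  have H := is_deriveZ N^-1 (is_deriveB (is_deriveN (dk x x)) (dk y y)).
  rewrite !kXx !subr0 oppr0 scaler0 in H.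
  by apply: (is_derive_eq (f := _)) => //; under eq_fun do rewrite pE; exact: H.
have dq : exists d, is_derive (0 : R) (1 : R) (fun t => Im (chi (E t))) d.
  have H := is_deriveZ N^-1 (is_deriveB (dk x y) (dk y x)).
  by eexists; under eq_fun do rewrite qE; exact: H.
have [d dqd] := dq.
have dE : char_diff chi X = d.
  by rewrite /char_diff derive1E; apply: derive_val.
rewrite dE; split => //.
- have H1 := vderiv_exp_app X 0 x; rewrite lfun_exp0 id_lfunE in H1.
  apply: (vderiv_unique H1).
  have -> : (fun s : R => lfun_exp (s *: X) x) =
      fun s => Re (chi (E s)) *: x + Im (chi (E s)) *: (- y).
    by apply/funext => s; have [-> _] := W _ (AX s); rewrite scalerN.
  by have := vderivD (vderivZ x dp) (vderivZ (- y) dqd); rewrite scale0r add0r scalerN scaleNr.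
- have H1 := vderiv_exp_app X 0 y; rewrite lfun_exp0 id_lfunE in H1.
  apply: (vderiv_unique H1).
  have -> : (fun s : R => lfun_exp (s *: X) y) =
      fun s => Re (chi (E s)) *: y + Im (chi (E s)) *: x.
    by apply/funext => s; have [_ ->] := W _ (AX s).
  by have := vderivD (vderivZ y dp) (vderivZ x dqd); rewrite scale0r add0r.
Qed.

Lemma char_diff_restr chi X : lie_of A X ->
  char_diff (char_restr (id_comp A) chi) X = char_diff chi X.
Proof.
move=> AX; rewrite /char_diff; congr (derive1 _ 0); apply/funext => t.
by rewrite /char_restr patchT // inE; exact: id_comp_exp.
Qed.

(** The stabilizer [K] of [x] and [y] in [A] is a closed subgroup. When the differential vanishes,
    the Lie algebra of [A] kills [x] and [y], so [K] contains its exponentials and hence the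
    identity component. *)
Lemma char_trivial_on_id_comp chi x y :
  weight_space A chi (x, y) -> (x, y) != 0 ->
  (forall X, lie_of A X -> char_diff chi X = 0) ->
  char_restr (id_comp A) chi = char0.
Proof.
move=> W xy0 chi0; have [[AG A1 AM AV] clA _ _] := A_star.
have A_lker a : A a -> lker a == 0%VS by move=> /AG[].
pose K := A `&` ([set a : 'End(g0) | a x = x] `&` [set a : 'End(g0) | a y = y]).
have cA : compact A by exact: lie_aut_compact clA.
have idK : id_comp A `<=` K.
  apply: id_comp_sub => //.
  - apply: closedI; first by apply: compact_closed => //; exact: lfun_hausdorff.
    by apply: closedI; exact: closed_lfun_app.
  - by move=> a [].
  - by split => //; split; rewrite /= id_lfunE.
  - move=> a b [Aa [/= ax ay]] [Ab [/= bx by_]]; split; first exact: AM.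
    by split; rewrite /= comp_lfunE ?bx ?by_.
  - move=> a [Aa [/= ax ay]]; split; first exact: AV.
    split => /=; first by rewrite -{1}ax lker0_lfunK // A_lker.
    by rewrite -{1}ay lker0_lfunK // A_lker.
  - move=> X AX; have [_ Xx Xy] := derive_weight W xy0 AX.
    rewrite chi0 // oppr0 !scale0r in Xx Xy.
    split; first by have := AX 1; rewrite scale1r.
    have fixX z : X z = 0 -> lfun_exp X z = z.
      move=> Xz; have := @vderiv_flow_unique _ _ X (fun=> z) 1.
      rewrite scale1r => <- // s; rewrite Xz; exact: vderiv_cst.
    by split; exact: fixX.
apply/funext => a; rewrite /char_restr /char0.
have [Aa|nAa] := pselect (id_comp A a); last by rewrite patchC // inE.
rewrite patchT ?inE //; have [Aa' [/= ax ay]] := idK _ Aa.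
have : (chi a - 1) *: ((x, y) : cplx g0) = 0.
  by rewrite scalerBl scale1r -W // /cplx_act /= ax ay subrr.
move/eqP; rewrite scaler_eq0 (negPf xy0) orbF subr_eq0; exact/eqP.
Qed.

End Weights.

(** * Infinitesimal invariance of the metric *)

Section CharVec.
Context {R : realType} {g0 : vectType R} (br : g0 -> g0 -> g0).
Hypothesis br_lie : is_lie_bracket br.
Hypothesis br_compact : compact_semisimple br.
Variables (A : set 'End(g0)) (m : 'End(g0) -> 'End(g0) -> R).
Hypothesis A_star : star_subgroup (lie_aut br) A.
Hypothesis m_metric : biinvariant_metric (lie_aut br) m.
Implicit Types (x y z w : g0) (X Y : 'End(g0)) (chi psi : 'End(g0) -> R[i]).

Local Notation der := (lie_of (lie_aut br)).

Lemma der_subspace : subspace_set der.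
Proof. rewrite lie_of_aut //; exact: derivation_subspace. Qed.

Lemma der_lie_of : lie_of A `<=` der.
Proof. by rewrite (star_lie_of br_lie A_star) lie_of_aut // => X []. Qed.

Lemma der_ad x : der (ad br x).
Proof. by rewrite lie_of_aut //; exact: ad_derivation. Qed.

Lemma metric0l X : der X -> m 0 X = 0.
Proof.
move=> dX; have [d0 _] := der_subspace.
have H := metric_linear m_metric 1 d0 d0 dX.
rewrite scale1r addr0 mul1r in H.
by apply: (addrI (m 0 X)); rewrite addr0 -H.
Qed.

Lemma der_conj g X : lie_aut br g -> der X -> der (g \o X \o g^-1)%VF.
Proof.
move=> [g0' gbr]; rewrite lie_of_aut // => dX x y.
have gK u : g ((g^-1)%VF u) = u.
  by have /lfunP/(_ u) := lker0_compfV g0'; rewrite comp_lfunE id_lfunE.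
have -> : br x y = g (br ((g^-1)%VF x) ((g^-1)%VF y)) by rewrite gbr !gK.
rewrite !comp_lfunE lker0_lfunK // dX linearD /= !gbr !gK.
by [].
Qed.

Lemma metricZl c X Y : der X -> der Y -> m (c *: X) Y = c * m X Y.
Proof.
move=> dX dY; have [d0 _] := der_subspace.
by have := metric_linear m_metric c dX d0 dY; rewrite metric0l // !addr0.
Qed.

Lemma metric_inj X Y : lie_of A X -> lie_of A Y ->
  (forall Z, lie_of A Z -> m X Z = m Y Z) -> X = Y.
Proof.
move=> AX AY XY; apply/eqP; rewrite -subr_eq0; apply: contraT => XY0.
have [_ LP] := lie_of_subspace A_star.
have AXY : lie_of A (X - Y) by rewrite -scaleN1r addrC; exact: LP.
have := metric_pos m_metric (der_lie_of AXY) XY0.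
rewrite -{1}scaleN1r addrC (metric_linear m_metric) ?XY //; try exact: der_lie_of.
by rewrite mulN1r addNr ltxx.
Qed.

(* Differentiated Ad-invariance; the right-hand side is [- m (ad w) [ad z, X]]. *)
Lemma metric_invariant z w X : der X -> m (ad br (br z w)) X = m (ad br w) (ad br (X z)).
Proof.
move=> dX.
have [U UE] := subspace_vspace der_subspace.
have UP Y : der Y <-> Y \in U by rewrite -UE.
(* [m] is controlled on derivations only, so it is extended through a projection. *)
pose mt X Y := m (projv U X) (projv U Y).
have mtl Y : scalar (mt^~ Y).
  by move=> c X1 X2; rewrite /mt linearP (metric_linear m_metric) //; apply/UP/memv_proj.
have mts X1 X2 : mt X1 X2 = mt X2 X1.
  by rewrite /mt (Defs.metric_sym m_metric) //; apply/UP/memv_proj.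
have mtr Y : scalar (mt Y) by move=> c X1 X2; rewrite !(mts Y) mtl.
have mtE X1 X2 : der X1 -> der X2 -> mt X1 X2 = m X1 X2.
  by move=> /UP d1 /UP d2; rewrite /mt !projv_id.
pose Z := ad br z.
pose AD : {linear g0 -> 'End(g0)} :=
  HB.pack (ad br) (GRing.isLinear.Build _ _ _ _ (ad br) (ad_is_linear br_lie)).
have F' := vderiv_linear AD (vderiv_exp_app Z 0 w).
have comp_l (Y : 'End(g0)) : linear (fun f : 'End(g0) => (f \o Y)%VF).
  by move=> c f g; rewrite comp_lfunDl -comp_lfunZl.
have comp_r (Y : 'End(g0)) : linear (fun f : 'End(g0) => (Y \o f)%VF).
  by move=> c f g; rewrite comp_lfunDr -comp_lfunZr.
have G' := vderiv_bilinear comp_l comp_r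
  (vderiv_bilinear comp_l comp_r (vderiv_exp Z 0) (vderiv_cst X 0)) (vderiv_exp (- Z) 0).
have autZ t : lie_aut br (lfun_exp (t *: Z)) by exact: der_ad.
have D := is_derive_form mtl mtr F' G'.
rewrite /= !lfun_exp0 !id_lfunE !comp_lfun1r !comp_lfun1l addr0 in D.
rewrite comp_lfunNr -/Z in D.
(* [ad] of exp (s Z) w is the conjugate of [ad br w] by exp (s Z), so both arguments move under the
   same Ad. *)
have const : (fun s => mt (ad br (lfun_exp (s *: Z) w))
    ((lfun_exp (s *: Z) \o X) \o lfun_exp (s *: - Z))%VF) = cst (m (ad br w) X).
  apply/funext => s /=.
  have inv : (lfun_exp (s *: - Z) = (lfun_exp (s *: Z))^-1)%VF.
    by rewrite lfun_exp_inv scalerN.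
  rewrite ad_autV // inv comp_lfunA -(metric_Ad m_metric (autZ s) (der_ad w) dX).
  apply: mtE; last exact: der_conj.
  by rewrite -comp_lfunA -ad_autV //; exact: der_ad.
rewrite const in D; have [_] := D; rewrite derive_cst adE //.
(* The commutator of [Z] and [X] is computed by the Leibniz rule for [X]. *)
have -> : ((Z \o X)%VF + - (X \o Z)%VF) = - ad br (X z).
  apply/lfunP => u; rewrite add_lfunE !opp_lfunE !comp_lfunE /Z !adE //.
  by move: dX; rewrite lie_of_aut // => ->; rewrite opprD addrCA subrr addr0.
pose M : {scalar 'End(g0)} := HB.pack (mt (ad br w))
  (GRing.isLinear.Build _ _ _ _ (mt (ad br w)) (mtr (ad br w))).
rewrite -[mt (ad br w) _]/(M _) linearN /= !mtE //; try exact: der_ad.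
by move=> /esym/eqP; rewrite subr_eq0 => /eqP.
Qed.

End CharVec.

(** * The vector representing a root *)

Section RootVectors.
Context {R : realType} {g0 : vectType R} (br : g0 -> g0 -> g0).
Hypothesis br_lie : is_lie_bracket br.
Hypothesis br_compact : compact_semisimple br.
Variables (A : set 'End(g0)) (m : 'End(g0) -> 'End(g0) -> R).
Hypothesis A_star : star_subgroup (lie_aut br) A.
Hypothesis m_metric : biinvariant_metric (lie_aut br) m.
Variables (chi : 'End(g0) -> R[i]) (x y : g0).
Hypothesis chi_char : character A chi.
Hypothesis chi_res : char_restr (id_comp A) chi <> char0.
Hypothesis xy_weight : weight_space A chi (x, y).
Hypothesis xy_neq0 : (x, y) != 0.
Implicit Types X : 'End(g0).

Let chi' := char_restr (id_comp A) chi.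

(** Each [a] in [A] acts on the pair (x, y) by a matrix of determinant |chi a|^2 = 1, hence fixes
    [x, y]. So [ad [x, y]] commutes with [A], and [star_lie_of] applies. *)
Lemma weight_bracket_lie : lie_of A (ad br (br x y)).
Proof.
rewrite (star_lie_of br_lie A_star); split; first exact: ad_derivation.
move=> a Aa; have [[AG _ _ _] _ _ _] := A_star; have aG := AG _ Aa.
rewrite -(ad_aut br_lie _ aG); congr (ad br _ \o a)%VF.
have [_ abr] := aG; have /weight_spaceP /(_ a Aa) [ax ay] := xy_weight.
have [_ chi1 _ _] := chi_char.
have := add_Re2_Im2 (chi a); rewrite chi1 // expr1n => -[pq].
rewrite abr ax ay (brBl br_lie) !(brDr br_lie) !(brZl br_lie) !(brZr br_lie).
rewrite !(lie_alternating br_lie) !scaler0 addr0 add0r (brC br_lie y x) !scalerN opprK.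
by rewrite !scalerA -scalerDl -!expr2 pq scale1r.
Qed.

(** Invariance moves the bracket onto [X x], which is - [char_diff chi X] times [y]. *)
Lemma metric_weight X : lie_of A X ->
  m (ad br (br x y)) X = - char_diff chi X * m (ad br y) (ad br y).
Proof.
move=> AX; have dX := der_lie_of br_lie A_star AX.
rewrite (metric_invariant br_lie m_metric) //.
have [_ -> _] := derive_weight br_lie br_compact A_star xy_weight xy_neq0 AX.
have adZ c z : ad br (c *: z) = c *: ad br z.
  have := ad_is_linear br_lie c z 0; rewrite addr0 => ->.
  by rewrite (ad0 br_lie) addr0.
rewrite adZ (Defs.metric_sym m_metric) //; last 2 first.
- exact: der_ad.
- by rewrite -adZ; exact: der_ad.
by rewrite (metricZl br_lie m_metric) //; exact: der_ad.
Qed.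

(** If [y] were 0, then [X y = char_diff chi X *: x] with [x] nonzero would make the differential
    vanish, and [chi] would be trivial on the identity component. *)
Lemma metric_weight_gt0 : 0 < m (ad br y) (ad br y).
Proof.
apply: (metric_pos m_metric); first exact: der_ad.
apply/eqP => /(ad_inj br_lie br_compact) y0; apply: chi_res.
apply: (char_trivial_on_id_comp br_lie br_compact A_star xy_weight xy_neq0) => X AX.
have [_ _] := derive_weight br_lie br_compact A_star xy_weight xy_neq0 AX.
rewrite y0 linear0 => /esym/eqP; rewrite scaler_eq0 => /orP[/eqP//|/eqP x0].
by move: xy_neq0; rewrite x0 y0 eqxx.
Qed.

(** Rescaling [metric_weight] gives a representative, and definiteness of [m] leaves [xget] no other
    candidate. *)
Lemma char_vecE :
  char_vec m (id_comp A) chi' = - (m (ad br y) (ad br y))^-1 *: ad br (br x y).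
Proof.
have c0 := metric_weight_gt0; set v := _ *: _.
have [L0 LP] := lie_of_subspace A_star.
have Av : lie_of A v.
  by have := LP (- (m (ad br y) (ad br y))^-1) _ _ weight_bracket_lie L0; rewrite addr0.
have vP X : lie_of A X -> m v X = char_diff chi X.
  move=> AX; rewrite (metricZl br_lie m_metric) ?metric_weight //.
  - by rewrite mulNr mulNr mulrN opprK mulrCA mulVf ?mulr1 // gt_eqF.
  - exact: der_ad.
  - exact: (der_lie_of br_lie A_star).
rewrite /char_vec (lie_of_id_comp A); apply: xget_unique.
  by split => // X AX; rewrite vP // char_diff_restr.
move=> Y [AY YP]; apply: (metric_inj br_lie A_star m_metric) => // X AX.
by rewrite YP // vP // char_diff_restr.
Qed.

Lemma char_vec_lie : lie_of A (char_vec m (id_comp A) chi').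
Proof.
have [L0 LP] := lie_of_subspace A_star; rewrite char_vecE.
by have := LP (- (m (ad br y) (ad br y))^-1) _ _ weight_bracket_lie L0; rewrite addr0.
Qed.

Lemma metric_char_vec X : lie_of A X ->
  m (char_vec m (id_comp A) chi') X = char_diff chi X.
Proof.
move=> AX; have c0 := metric_weight_gt0.
rewrite char_vecE (metricZl br_lie m_metric) ?metric_weight //.
- by rewrite mulNr mulNr mulrN opprK mulrCA mulVf ?mulr1 // gt_eqF.
- exact: der_ad.
- exact: (der_lie_of br_lie A_star).
Qed.

Lemma char_inner_gt0 : 0 < char_inner m (id_comp A) chi' chi'.
Proof.
apply: (metric_pos m_metric); first exact: (der_lie_of br_lie A_star char_vec_lie).
apply/eqP => v0; apply: chi_res.
apply: (char_trivial_on_id_comp br_lie br_compact A_star xy_weight xy_neq0) => X AX.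
rewrite -metric_char_vec // v0 (metric0l br_lie m_metric) //.
exact: (der_lie_of br_lie A_star).
Qed.

End RootVectors.

(** * The complexified Lie algebra and its ideals *)

Section ComplexBracket.
Context {R : realType} {g0 : vectType R} (br : g0 -> g0 -> g0).
Hypothesis br_lie : is_lie_bracket br.
Implicit Types (u v w z : cplx g0) (c : R[i]).

Local Notation Re := complex.Re.
Local Notation Im := complex.Im.
Local Notation cbr := (cplx_br br).

Lemma cplx_scaleE c u : c *: u =
  (Re c *: u.1 - Im c *: u.2, Re c *: u.2 + Im c *: u.1) :> cplx g0.
Proof. by []. Qed.

Lemma cplx_brC u v : cbr u v = - cbr v u.
Proof.
rewrite /cplx_br; congr pair => /=.
  by rewrite opprB (brC br_lie u.1) (brC br_lie u.2) opprK addrC.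
by rewrite opprD (brC br_lie u.1) (brC br_lie u.2) addrC.
Qed.

Lemma cplx_brDl u v w : cbr (u + v) w = cbr u w + cbr v w.
Proof.
rewrite /cplx_br /= !(brDl br_lie); congr pair => /=; last by rewrite addrACA.
by rewrite opprD addrACA.
Qed.

Lemma cplx_brDr u v w : cbr w (u + v) = cbr w u + cbr w v.
Proof. by rewrite !(cplx_brC w) cplx_brDl opprD. Qed.

Lemma cplx_brZl c u w : cbr (c *: u) w = c *: cbr u w.
Proof.
rewrite /cplx_br !cplx_scaleE /=; congr pair;
  rewrite !(brDl br_lie, brNl br_lie, brZl br_lie) !(scalerDr, scalerN, opprD, opprK).
  by rewrite (AC (2*2) ((1*3)*(2*4)))%AC /= [X in _ + X]addrC.
by rewrite (AC (2*2) ((1*3)*(2*4)))%AC /= [X in _ + X]addrC.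
Qed.

Lemma cplx_brZr c u w : cbr w (c *: u) = c *: cbr w u.
Proof. by rewrite cplx_brC cplx_brZl -scalerN -cplx_brC. Qed.

Lemma cplx_br0r u : cbr u 0 = 0.
Proof. by apply: (addrI (cbr u 0)); rewrite -cplx_brDr !addr0. Qed.

Lemma cplx_br0l u : cbr 0 u = 0.
Proof. by rewrite cplx_brC cplx_br0r oppr0. Qed.

Lemma cplx_br_jacobi u v w : cbr (cbr u v) w = cbr u (cbr v w) - cbr v (cbr u w).
Proof.
case: u v w => [u1 u2] [v1 v2] [w1 w2]; rewrite /cplx_br /=; congr pair => /=;
  apply: v2r_inj; apply/rowP => k;
  rewrite !(brDl br_lie, brNl br_lie, brDr br_lie, brNr br_lie) !(br_jacobi br_lie);
  rewrite !(linearD, linearN) !mxE; ring.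
Qed.

Lemma cplx_actD f u v : cplx_act f (u + v) = cplx_act f u + cplx_act f v.
Proof. by rewrite /cplx_act !linearD. Qed.

Lemma cplx_actZ f c u : cplx_act f (c *: u) = c *: cplx_act f u.
Proof. by rewrite /cplx_act !cplx_scaleE /= linearB linearD !linearZ. Qed.

Lemma cplx_act0 f : cplx_act f 0 = 0 :> cplx g0.
Proof. by rewrite /cplx_act !linear0. Qed.

Lemma cplx_act_br f u v : lie_aut br f ->
  cplx_act f (cbr u v) = cbr (cplx_act f u) (cplx_act f v).
Proof. by move=> [_ fbr]; rewrite /cplx_act /cplx_br /= linearB linearD /= !fbr. Qed.

Lemma cplx_act_derivation X u v : lfun_derivation br X ->
  cplx_act X (cbr u v) = cbr (cplx_act X u) v + cbr u (cplx_act X v).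
Proof.
move=> dX; rewrite /cplx_act /cplx_br /= linearB linearD /= !dX; congr pair => /=.
  by rewrite opprD addrACA.
by rewrite addrACA.
Qed.

Lemma weight_subspace A chi : subspace_set (weight_space A chi : set (cplx g0)).
Proof.
split=> [a _|c u v Hu Hv a Aa]; first by rewrite cplx_act0 scaler0.
by rewrite cplx_actD cplx_actZ Hu // Hv // scalerDr !scalerA mulrC.
Qed.

Lemma weight_br A chi psi u v : A `<=` lie_aut br ->
  weight_space A chi u -> weight_space A psi v ->
  weight_space A (fun a => chi a * psi a) (cbr u v).
Proof.
move=> AG Hu Hv a Aa; rewrite cplx_act_br ?Hu ?Hv //; last exact: AG.
by rewrite cplx_brZl cplx_brZr scalerA.
Qed.

Lemma weight_neq0 A chi : weight_space A chi <> [set 0] ->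
  exists2 u : cplx g0, u != 0 & weight_space A chi u.
Proof.
move=> H; apply: contrapT => noY; apply: H; apply/seteqP; split => u Hu.
  by apply/eqP; apply: contraT => u0; case: noY; exists u.
by rewrite Hu; case: (weight_subspace A chi).
Qed.

Hypothesis br_compact : compact_semisimple br.

Lemma cplx_center0 u : (forall v, cbr v u = 0) -> u = 0.
Proof.
case: u => x y H; congr pair; apply: (center0 br_lie br_compact) => z.
  have [+ _] := H (z, 0); rewrite /= (br0l br_lie) subr0 (brC br_lie) => /eqP.
  by rewrite oppr_eq0 => /eqP.
have [_] := H (z, 0); rewrite /= (br0l br_lie) addr0 (brC br_lie) => /eqP.
by rewrite oppr_eq0 => /eqP.
Qed.

(* Real part of the Hermitian form [- killing(u, conj v)]. The orthogonal of a complex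
   subspace is the same for both, so real linear algebra suffices. *)
Definition hermitian_re u v : R := - killing br u.1 v.1 - killing br u.2 v.2.

Lemma hermitian_re_inner : @inner_product R (g0 * g0)%type hermitian_re.
Proof.
have [Bl Bs Bp] := killing_inner br_lie br_compact.
have B0 (z : g0) : 0 <= - killing br z z.
  by have [->|/Bp /ltW //] := eqVneq z 0; rewrite (killing0l br_lie) oppr0.
split=> [[y1 y2] c [u1 u2] [v1 v2]|[x1 x2] [y1 y2]|[x1 x2]]; rewrite /hermitian_re /=.
- by rewrite !(killing_linear br_lie); ring.
- by rewrite (killing_sym _ x1) (killing_sym _ x2).
- rewrite -pair_eqE /= negb_and => /orP[/Bp x0|/Bp y0]; first by rewrite ltr_wpDr.
  by rewrite ltr_wpDl.
Qed.

Variable A : set 'End(g0).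
Hypothesis A_sub : subgroup A (lie_aut br).
Variable I : set (cplx g0).
Hypothesis I_ideal : A_ideal br A I.

Let I_sub : subspace_set I. Proof. by case: I_ideal. Qed.
Let I_br u v : I v -> I (cbr u v). Proof. by case: I_ideal => _ + _; apply. Qed.
Let I_act a v : A a -> I v -> I (cplx_act a v).
Proof. by case: I_ideal => _ _; apply. Qed.
Let IZ c u : I u -> I (c *: u).
Proof. by move=> Iu; have [I0 IP] := I_sub; rewrite -[_ *: u]addr0; exact: IP. Qed.

Definition orth_set : set (cplx g0) := [set v | forall u, I u -> hermitian_re u v = 0].

Let Hsym u v : hermitian_re u v = hermitian_re v u.
Proof. exact: (inner_sym hermitian_re_inner). Qed.

(** For the Hermitian form, the adjoint of the bracket with z is minus the bracket with its
    conjugate, scalars pass to conjugates, and automorphisms are unitary. Stability of [I] therefore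
    passes to its orthogonal. *)
Lemma orth_ideal : A_ideal br A orth_set.
Proof.
have kl := killing_linear br_lie.
have kZl (d : R) (v w : g0) : killing br (d *: v) w = d * killing br v w.
  by rewrite -[_ *: v]addr0 kl (killing0l br_lie) addr0.
have kDl (u v w : g0) : killing br (u + v) w = killing br u w + killing br v w.
  by rewrite -[u]scale1r kl mul1r scale1r.
have kNl (u w : g0) : killing br (- u) w = - killing br u w by rewrite -scaleN1r kZl mulN1r.
have kC := killing_sym br.
have HD u v w : hermitian_re w (u + v) = hermitian_re w u + hermitian_re w v.
  by rewrite /hermitian_re /= !(kC w.1) !(kC w.2) !kDl; ring.
have HZ c u w : hermitian_re w (c *: u) = hermitian_re (c^*%C *: w) u.
  case: c u w => p q [u1 u2] [w1 w2]; rewrite !cplx_scaleE /hermitian_re /=.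
  rewrite !(kC w1) !(kC w2) !(kDl, kNl, kZl) !(kC w1) !(kC w2); ring.
split.
- split=> [u Iu|c u v Hu Hv w Iw].
    by rewrite Hsym /hermitian_re /= !(killing0l br_lie) subr0 oppr0.
  rewrite HD Hv // addr0 HZ; apply: Hu; exact: IZ.
- move=> [z1 z2] [v1 v2] Hv [w1 w2] Iw.
  have := Hv _ (I_br (z1, - z2) Iw); rewrite /hermitian_re /=.
  rewrite !(brNl br_lie) !(kDl, kNl) => H.
  rewrite !(kC w1) !(kC w2) !(kDl, kNl) !(killing_invariant br_lie).
  rewrite !(kC v1) !(kC v2); apply/eqP; rewrite -oppr_eq0 -H; apply/eqP; ring.
- move=> a v Aa Hv w Iw; have [AG _ _ AV] := A_sub; have aG := AG _ Aa; have [a0 _] := aG.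
  have aK (z : g0) : a ((a^-1)%VF z) = z.
    by have /lfunP/(_ z) := lker0_compfV a0; rewrite comp_lfunE id_lfunE.
  have -> : w = cplx_act a (cplx_act (a^-1)%VF w).
    by case: w Iw => w1 w2 _; rewrite /cplx_act /= !aK.
  rewrite /hermitian_re /= !(killing_aut br_lie) //.
  by apply: (Hv (cplx_act (a^-1)%VF w)); apply: I_act => //; exact: AV.
Qed.

Lemma orth_cap u : I u -> orth_set u -> u = 0.
Proof. by move=> Iu Ju; apply: (inner_eq0 hermitian_re_inner); exact: Ju. Qed.

Lemma orth_decomp w : exists u v, [/\ I u, orth_set v & w = u + v].
Proof.
(* Restriction of scalars: the complex subspace is viewed as a real one. *)
have Isub : @subspace_set R (g0 * g0)%type I.
  have [I0 IP] := I_sub; split => // c u v Iu Iv.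
  have := IP (c%:C)%C u v Iu Iv.
  by rewrite cplx_scaleE /= !scale0r subr0 addr0; case: (u).
by have [u [v [Iu Jv ->]]] := orthogonal_decomposition w hermitian_re_inner Isub; exists u, v.
Qed.

Lemma orth_br u v : I u -> orth_set v -> cbr u v = 0.
Proof.
move=> Iu Jv; have [_ Jbr _] := orth_ideal; apply: orth_cap; last exact: Jbr.
by rewrite cplx_brC -scaleN1r; apply: IZ; exact: I_br.
Qed.

(* For [u] in [I] and [v] in the orthogonal ideal, [ad u ad v = 0], so [u] and [v] are
   also orthogonal for the complex-bilinear Killing form. *)
Lemma ideal_conj x y : I (x, y) -> I (x, - y).
Proof.
move=> Iu; have [a [b [Ia Jb E]]] := orth_decomp (x, - y).
suff b0 : b = 0 by rewrite E b0 addr0.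
apply: (inner_eq0 hermitian_re_inner).
have [Hl Hs _] := hermitian_re_inner.
have : hermitian_re (x, - y) b = 0.
  have [_ Jbr _] := orth_ideal.
  (* The real part of [x + i y, [b, w]] = 0 for real [w] says that ad x ad b.1 = ad y ad b.2, so the
     traces agree. *)
  have kill0 : killing br x b.1 = killing br y b.2.
    rewrite /killing; congr (\tr (f2mx _)); apply/lfunP => w.
    have J1 : orth_set (cbr b (w, 0)).
      rewrite cplx_brC -scaleN1r; have [[J0 JP] _ _] := orth_ideal.
      by rewrite -[_ *: _]addr0; apply: JP => //; exact: Jbr.
    have := orth_br Iu J1; rewrite /cplx_br /= !(br0r br_lie) subr0 add0r => -[H _].
    by rewrite !comp_lfunE !(adE br_lie); apply/eqP; rewrite -subr_eq0 H.
  rewrite /hermitian_re /= -scaleN1r.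
  have := killing_linear br_lie b.2 (-1) y 0; rewrite addr0 (killing0l br_lie) addr0 => ->.
  by rewrite kill0; ring.
rewrite E; have := Hl b 1 a b; rewrite scale1r mul1r => ->.
by rewrite (Jb a) // add0r.
Qed.

End ComplexBracket.

(** * Simplicity and irreducibility *)

Section SimpleIrreducible.
Context {R : realType} {g0 : vectType R} (br : g0 -> g0 -> g0).
Variables (A : set 'End(g0)) (m : 'End(g0) -> 'End(g0) -> R).
Hypothesis br_lie : is_lie_bracket br.
Hypothesis br_compact : compact_semisimple br.
Hypothesis A_star : star_subgroup (lie_aut br) A.
Hypothesis m_metric : biinvariant_metric (lie_aut br) m.
Hypothesis g_eq_infty : g_infty br A = [set: cplx g0].
Implicit Types (u v w : cplx g0) (alpha beta chi psi : 'End(g0) -> R[i]).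

Local Notation roots := Defs.roots.
Local Notation cbr := (cplx_br br).
Local Notation res := (char_restr (id_comp A)).
Local Notation inner := (char_inner m (id_comp A)).

(** The form in which [g_eq_infty] is used: the root spaces nontrivial on the identity component
    generate the Lie algebra. *)
Lemma subalgebra_full (N : set (cplx g0)) : subspace_set N ->
  (forall u v, N u -> N v -> N (cbr u v)) ->
  (forall alpha, roots A alpha -> res alpha <> char0 -> weight_space A alpha `<=` N) ->
  N = setT.
Proof.
move=> Nsub Nbr NA; have [N0 NP] := Nsub.
have resN chi : chi <> char0 -> res_root_space A chi `<=` N.
  move=> chi0; apply: smallest_sub => // u [alpha [ra ares] au].
  by apply: (NA alpha) => //; rewrite ares.
have res0 chi : res_roots A chi -> chi <> char0 by move=> [alpha [_ ?] <-].
apply/seteqP; split => // w _.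
have : g_infty br A w by rewrite g_eq_infty.
move=> [u Hu [v Hv <-]]; rewrite -[u]scale1r; apply: NP.
- move: u Hu; apply: smallest_sub => // u [chi /res0 chi0]; exact: resN.
- move: v Hv; apply: smallest_sub => // v [chi /res0 chi0].
  apply: smallest_sub => // _ [a Ha [b Hb <-]]; apply: Nbr; first exact: resN Ha.
  (* [resN] applies to the opposite of [chi] whether or not it is a restricted root; only its
     nontriviality has to be checked. *)
  apply: resN Hb => opp0; apply: chi0; apply/funext => x.
  by have := congr1 (fun f => (f x)^-1) opp0; rewrite /char_opp /char0 invrK invr1.
Qed.

Lemma character_mul alpha beta : character A alpha -> character A beta ->
  character A (fun a => alpha a * beta a).
Proof.
move=> [a1 an aM [aR aI]] [b1 bn bM [bR bI]]; split.
- by move=> a nAa; rewrite a1 // b1 // mulr1.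
- by move=> a Aa; rewrite normrM an // bn // mulr1.
- by move=> a b Aa Ab; rewrite aM // bM // mulrACA.
split.
- rewrite (_ : (fun a => _) = fun a => complex.Re (alpha a) * complex.Re (beta a) -
     complex.Im (alpha a) * complex.Im (beta a)); last first.
    by apply/funext => a; case: (alpha a) (beta a) => [p q] [r s].
  by move=> a; apply: cvgB; apply: cvgM; [exact: aR|exact: bR|exact: aI|exact: bI].
- rewrite (_ : (fun a => _) = fun a => complex.Re (alpha a) * complex.Im (beta a) +
     complex.Im (alpha a) * complex.Re (beta a)); last first.
    by apply/funext => a; case: (alpha a) (beta a) => [p q] [r s].
  by move=> a; apply: cvgD; apply: cvgM; [exact: aR|exact: bI|exact: aI|exact: bR].
Qed.

(** Eigenvalues of the derivation [X] add on a nonzero bracket, and [derive_weight] identifies them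
    with the differentials. *)
Lemma char_diff_mul alpha beta u v X : weight_space A alpha u -> weight_space A beta v ->
  cbr u v != 0 -> lie_of A X ->
  char_diff (fun a => alpha a * beta a) X = char_diff alpha X + char_diff beta X.
Proof.
move=> Hu Hv uv0 AX; have [[AG _ _ _] _ _ _] := A_star.
have u0 : u != 0 by apply: contraNneq uv0 => ->; rewrite cplx_br0l.
have v0 : v != 0 by apply: contraNneq uv0 => ->; rewrite cplx_br0r.
pose iR (t : R) : R[i] := Complex 0 t.
have actE chi w : weight_space A chi w -> w != 0 ->
    cplx_act X w = iR (char_diff chi X) *: w.
  case: w => x y Hw w0; have [_ xE yE] := derive_weight br_lie br_compact A_star Hw w0 AX.
  by rewrite /cplx_act /= xE yE cplx_scaleE /= !scale0r !add0r scaleNr.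
have dX : lfun_derivation br X.
  by have := der_lie_of br_lie A_star AX; rewrite lie_of_aut.
have := cplx_act_derivation u v dX.
rewrite (actE _ _ (weight_br br_lie AG Hu Hv) uv0) (actE _ _ Hu u0) (actE _ _ Hv v0).
rewrite (cplx_brZl br_lie) (cplx_brZr br_lie) -scalerDl => /eqP.
rewrite -subr_eq0 -scalerBl scaler_eq0 (negPf uv0) orbF subr_eq0 => /eqP [].
by [].
Qed.

Lemma orthogonal_root_spaces (S1 S2 : set ('End(g0) -> R[i])) alpha beta u v :
  S1 `|` S2 = res_roots A ->
  (forall chi psi, S1 chi -> S2 psi -> inner chi psi = 0) ->
  roots A alpha -> S1 (res alpha) -> roots A beta -> S2 (res beta) ->
  weight_space A alpha u -> weight_space A beta v -> cbr u v = 0.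
Proof.
move=> S12 orth ra Sa rb Sb Hu Hv; apply/eqP; apply: contraT => uv0.
have [[AG _ _ _] _ _ _] := A_star.
have u0 : u != 0 by apply: contraNneq uv0 => ->; rewrite cplx_br0l.
have v0 : v != 0 by apply: contraNneq uv0 => ->; rewrite cplx_br0r.
have [ca _ _] := ra; have [cb _ _] := rb.
have res0 chi : (S1 `|` S2) chi -> chi <> char0 by rewrite S12 => -[? [_ ?] <-].
have a0 : res alpha <> char0 by apply: res0; left.
have b0 : res beta <> char0 by apply: res0; right.
pose gam a := alpha a * beta a.
have cg : character A gam by exact: character_mul.
have Hg := weight_br br_lie AG Hu Hv.
have tg X : lie_of A X -> char_diff gam X = char_diff alpha X + char_diff beta X.
  by move=> AX; rewrite (char_diff_mul Hu Hv uv0 AX).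
case: u v Hu Hv u0 v0 uv0 Hg => [x y] [x' y'] Hu Hv u0 v0 uv0 Hg.
have vA := char_vec_lie br_lie br_compact A_star m_metric ca a0 Hu u0.
have vB := char_vec_lie br_lie br_compact A_star m_metric cb b0 Hv v0.
have mA := metric_char_vec br_lie br_compact A_star m_metric ca a0 Hu u0.
have mB := metric_char_vec br_lie br_compact A_star m_metric cb b0 Hv v0.
have aa := char_inner_gt0 br_lie br_compact A_star m_metric ca a0 Hu u0.
have bb := char_inner_gt0 br_lie br_compact A_star m_metric cb b0 Hv v0.
have ab := orth _ _ Sa Sb.
have dA := der_lie_of br_lie A_star vA; have dB := der_lie_of br_lie A_star vB.
rewrite /char_inner in aa bb ab.
have ba : m (char_vec m (id_comp A) (res beta)) (char_vec m (id_comp A) (res alpha)) = 0.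
  by rewrite (Defs.metric_sym m_metric).
(* If alpha + beta is trivial on the identity component, its differential vanishes at the vector of
   [alpha]; orthogonality then gives [alpha] length 0. *)
have [g1|g1] := pselect (res gam = char0).
  have : char_diff gam (char_vec m (id_comp A) (res alpha)) = 0.
    rewrite -(char_diff_restr _ vA) -/(res gam) g1 /char_diff /char0 /=.
    by rewrite derive1_cst.
  rewrite tg // -mA // -mB // ba addr0 => aa0.
  by rewrite aa0 ltxx in aa.
have rg : roots A gam.
  split => //.
    move=> gam1; apply: g1; apply/funext => a.
    by rewrite gam1 /char_restr /patch; case: ifP.
  by move=> /seteqP[/(_ _ Hg) /= g0' _]; rewrite g0' eqxx in uv0.
case E : (cbr (x, y) (x', y')) => [p q]; rewrite E in uv0 Hg.
have mG := metric_char_vec br_lie br_compact A_star m_metric cg g1 Hg uv0.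
have vG := char_vec_lie br_lie br_compact A_star m_metric cg g1 Hg uv0.
have dG := der_lie_of br_lie A_star vG.
have : (S1 `|` S2) (res gam) by rewrite S12; exists gam.
(* If the sum lies in [S1], pairing it with [beta] gives [beta] length 0; if it lies in [S2],
   pairing with [alpha] does the same for [alpha]. *)
move=> [/(fun h => orth _ _ h Sb)|/(orth _ _ Sa)]; rewrite /char_inner.
- by rewrite mG // tg // -mA // -mB // ab add0r => bb0; rewrite bb0 ltxx in bb.
- rewrite (Defs.metric_sym m_metric) // mG // tg // -mA // -mB // ba addr0 => aa0.
  by rewrite aa0 ltxx in aa.
Qed.

Lemma irreducible_of_simple : A_simple br A -> irreducible_roots m (id_comp A) (res_roots A).
Proof.
move=> simp [S1 [S2 [[chi1 S1chi] [chi2 S2chi] S12 _ orth]]]; apply: simp.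
have [[AG A1 AM AV] _ AC _] := A_star.
pose I : set (cplx g0) := [set u | forall beta v, roots A beta -> S2 (res beta) ->
   weight_space A beta v -> cbr u v = 0].
have S1I alpha u : roots A alpha -> S1 (res alpha) -> weight_space A alpha u -> I u.
  move=> ra Sa Hu beta v rb Sb Hv.
  exact: (orthogonal_root_spaces S12 orth ra Sa rb Sb Hu Hv).
have Isub : subspace_set I.
  split=> [beta v _ _ _|c u w Iu Iw beta v rb Sb Hv]; first exact: cplx_br0l.
  by rewrite cplx_brDl // cplx_brZl // (Iu beta) // (Iw beta) // scaler0 addr0.
have [I0 IP] := Isub.
exists I; split.
- split => //.
    (* The normalizer of [I] is a subalgebra; once it contains the root spaces, it is everything. *)
    pose N : set (cplx g0) := [set z | forall u, I u -> I (cbr z u)].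
    suff NT : N = setT.
      by move=> u v Iv; have Nu : N u; [rewrite NT|exact: Nu].
    apply: subalgebra_full.
    + split=> [u Iu|c z z' Nz Nz' u Iu]; first by rewrite cplx_br0l.
      by rewrite cplx_brDl // cplx_brZl //; apply: IP; [exact: Nz|exact: Nz'].
    + move=> z z' Nz Nz' u Iu; rewrite cplx_br_jacobi // addrC -scaleN1r.
      by apply: IP; [apply: Nz'; exact: Nz|apply: Nz; exact: Nz'].
    + move=> gam rg g1 z Hz u Iu.
      have : (S1 `|` S2) (res gam) by rewrite S12; exists gam.
      case=> [Sg|Sg].
        move=> beta v rb Sb Hv; rewrite cplx_br_jacobi // (Iu beta) // cplx_br0r //.
        by rewrite (orthogonal_root_spaces S12 orth rg Sg rb Sb Hz Hv) cplx_br0r // subr0.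
      by rewrite cplx_brC // (Iu gam) // oppr0.
  move=> a u Aa Iu beta v rb Sb Hv; have aG := AG _ Aa.
  have [[_ bn _ _] _ _] := rb.
  (* Apply [a] to [u, v] = 0 for a weight vector [v]; the factor [beta a] has modulus 1 and
     cancels. *)
  have : beta a *: cbr (cplx_act a u) v = 0.
    by rewrite -cplx_brZr // -Hv // -cplx_act_br // (Iu beta) // cplx_act0.
  move/eqP; rewrite scaler_eq0 => /orP[/eqP b0|/eqP //].
  by have := bn _ Aa; rewrite b0 normr0 => /eqP; rewrite eq_sym oner_eq0.
- have : res_roots A chi1 by rewrite -S12; left.
  move=> [alpha [ra _] ares]; have [_ _ /weight_neq0[u u0 Hu]] := ra.
  have Iu : I u by apply: (S1I alpha) => //; rewrite ares.
  by move=> IE; rewrite IE /= in Iu; rewrite Iu eqxx in u0.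
(* If [I] were everything, a root vector over [S2] would be central. *)
- have : res_roots A chi2 by rewrite -S12; right.
  move=> [beta [rb _] bres]; have [_ _ /weight_neq0[v v0 Hv]] := rb.
  move=> IT; move: v0; suff -> : v = 0 by rewrite eqxx.
  apply: (cplx_center0 br_lie br_compact) => u.
  have : I u by rewrite IT.
  by apply; [exact: rb|rewrite bres|].
Qed.

Section OrthogonalIdeals.
Variables I J : set (cplx g0).
Hypotheses (I_ideal : A_ideal br A I) (J_ideal : A_ideal br A J).
Hypothesis IJ0 : forall u, I u -> J u -> u = 0.
Hypothesis I_conj : forall x y, I (x, y) -> I (x, - y).

Lemma ideal_br0 u v : I u -> J v -> cbr u v = 0.
Proof.
move=> Iu Jv; have [[I0 IP] Ibr _] := I_ideal; have [_ Jbr _] := J_ideal.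
apply: IJ0; last exact: Jbr.
rewrite cplx_brC // -scaleN1r -[_ *: _]addr0; apply: IP => //; exact: Ibr.
Qed.

Lemma ideal_roots_orthogonal alpha beta u v :
  roots A alpha -> res alpha <> char0 -> weight_space A alpha u -> u != 0 -> I u ->
  roots A beta -> res beta <> char0 -> weight_space A beta v -> v != 0 -> J v ->
  inner (res alpha) (res beta) = 0.
Proof.
case: u v => [x y] [x' y'] [ca _ _] a0 Hu u0 Iu [cb _ _] b0 Hv v0 Jv.
have vA := char_vec_lie br_lie br_compact A_star m_metric ca a0 Hu u0.
have vB := char_vec_lie br_lie br_compact A_star m_metric cb b0 Hv v0.
have mB := metric_char_vec br_lie br_compact A_star m_metric cb b0 Hv v0.
have dA := der_lie_of br_lie A_star vA; have dB := der_lie_of br_lie A_star vB.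
have [_ xE yE] := derive_weight br_lie br_compact A_star Hv v0 vA.
rewrite /char_inner (Defs.metric_sym m_metric) // mB //.
have [_ Ibr _] := I_ideal.
(* The bracket of x + i y with its conjugate is - 2 i [x, y]. It lies in [I], so it kills x' + i
   y'. *)
have [t1 t2] : br (br x y) x' = 0 /\ br (br x y) y' = 0.
  have := ideal_br0 (Ibr (x, y) _ (I_conj Iu)) Jv; rewrite /cplx_br /=.
  rewrite !(brNr br_lie) !(lie_alternating br_lie) oppr0 subr0 (brC br_lie y x).
  rewrite -opprD !(brNl br_lie) opprK !(brDl br_lie) !(br0l br_lie) !add0r.
  have half (z : g0) : z + z = 0 -> z = 0.
    by move/eqP; rewrite -mulr2n -scaler_nat scaler_eq0 pnatr_eq0 /= => /eqP.
  by move=> -[/half y0 /eqP]; rewrite oppr_eq0 => /eqP/half x0.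
have vA0 z : br (br x y) z = 0 -> char_vec m (id_comp A) (res alpha) z = 0.
  move=> tz; rewrite (char_vecE br_lie br_compact A_star m_metric ca a0 Hu u0).
  by rewrite scale_lfunE adE // tz scaler0.
(* The vector of [alpha] kills [x'] and [y'], not both zero, so the eigenvalue equations make the
   differential of [beta] vanish on it. *)
rewrite !vA0 // in xE yE.
move/esym/eqP: xE; move/esym/eqP: yE; rewrite !scaler_eq0 oppr_eq0.
case: eqP => [-> //|_ /= /eqP x0 /eqP y0].
by rewrite x0 y0 eqxx in v0.
Qed.

End OrthogonalIdeals.

Lemma simple_of_irreducible : irreducible_roots m (id_comp A) (res_roots A) -> A_simple br A.
Proof.
move=> irr [I [I_ideal I_nz I_nT]]; apply: irr.
have [A_sub _ _ _] := A_star.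
pose J := orth_set br I.
have J_ideal : A_ideal br A J by exact: orth_ideal.
have IJ0 u : I u -> J u -> u = 0 by exact: orth_cap.
have dec w : exists u v, [/\ I u, J v & w = u + v].
  exact: (orth_decomp br_lie br_compact I_ideal).
have I_conj x y : I (x, y) -> I (x, - y).
  exact: (ideal_conj br_lie br_compact A_sub I_ideal).
have [[I0 IP] Ibr Iact] := I_ideal; have [[J0 JP] Jbr Jact] := J_ideal.
(* The two pieces of the splitting will be [meets I] and [meets J]. *)
pose meets (K : set (cplx g0)) := [set chi | exists alpha u,
  [/\ roots A alpha, res alpha = chi, chi <> char0 &
      [/\ weight_space A alpha u, u != 0 & K u]]].
have orth chi psi : meets I chi -> meets J psi -> inner chi psi = 0.
  move=> [alpha [u [ra <- a0 [Hu u0 Iu]]]] [beta [v [rb <- b0 [Hv v0 Jv]]]].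
  exact: (ideal_roots_orthogonal I_ideal J_ideal IJ0 I_conj ra a0 Hu u0 Iu rb b0 Hv v0 Jv).
have decw alpha w : weight_space A alpha w ->
    exists u v, [/\ I u, J v, w = u + v, weight_space A alpha u & weight_space A alpha v].
  move=> Hw; have [u [v [Iu Jv wE]]] := dec w; exists u, v.
  (* The defects of [u] and [v] from the weight equation are opposite and lie in [I] and [J]
     respectively, so both vanish. *)
  have key a : A a -> cplx_act a u - alpha a *: u = 0 /\ cplx_act a v - alpha a *: v = 0.
    move=> Aa; have := Hw _ Aa; rewrite wE cplx_actD scalerDr => H.
    have E : cplx_act a u - alpha a *: u = - (cplx_act a v - alpha a *: v).
      by apply/eqP; rewrite -subr_eq0 opprK addrACA H -opprD subrr.
    have d0 : cplx_act a u - alpha a *: u = 0.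
      apply: IJ0; first by rewrite addrC -scaleNr; apply: IP => //; exact: Iact.
      rewrite E opprB -[_ - _]addr0.
      have := JP (-1) (cplx_act a v) (alpha a *: v); rewrite scaleN1r addrC addr0; apply.
        exact: Jact.
      by rewrite -[_ *: _]addr0; exact: JP.
    by split => //; apply/eqP; rewrite -oppr_eq0 -E d0.
  split => // a Aa; have [/eqP + /eqP] := key a Aa; rewrite !subr_eq0.
    by move=> /eqP -> _.
  by move=> _ /eqP ->.
have pos alpha u : roots A alpha -> res alpha <> char0 -> weight_space A alpha u -> u != 0 ->
    0 < inner (res alpha) (res alpha).
  case: u => x y [ca _ _] a0 Hu u0.
  exact: (char_inner_gt0 br_lie br_compact A_star m_metric ca a0 Hu u0).
(* If no root occurs in [K'], all generating root spaces lie in [K]. With [I] and [J] in the two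
   orders, this shows that both pieces are nonempty. *)
have full (K K' : set (cplx g0)) : A_ideal br A K ->
    (forall alpha w, roots A alpha -> res alpha <> char0 -> weight_space A alpha w ->
       exists u v, [/\ K' u, K v, w = u + v,
                       weight_space A alpha u & weight_space A alpha v]) ->
    ~ (meets K' !=set0) -> K = setT.
  move=> [[K0 KP] Kbr _] decK noK'; apply: subalgebra_full => //.
    by move=> u v _ Kv; exact: Kbr.
  move=> alpha ra a0 w Hw; have [u [v [K'u Kv -> Hu Hv]]] := decK alpha w ra a0 Hw.
  have -> : u = 0; last by rewrite add0r.
  by apply/eqP; apply: contraT => u0; case: noK'; exists (res alpha), alpha, u.
exists (meets I), (meets J); split => //.
- apply: contrapT => noI; apply: I_nz.
  have JT : J = setT by apply: (full J I) => // alpha w _ _ Hw; exact: decw.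
  apply/seteqP; split => u /=; last by move=> ->.
  by move=> Iu; apply: IJ0 => //; rewrite JT.
- apply: contrapT => noJ; apply: I_nT.
  apply: (full I J) => // alpha w _ _ Hw.
  by have [u [v [Iu Jv -> Hu Hv]]] := decw _ _ Hw; exists v, u; split => //; rewrite addrC.
- apply/seteqP; split => chi.
    by move=> [] [alpha [u [ra ar chi0 _]]]; exists alpha => //; split => //; rewrite ar.
  move=> [alpha [ra a0] <-]; have [_ _ /weight_neq0[w w0 Hw]] := ra.
  have [u [v [Iu Jv wE Hu Hv]]] := decw _ _ Hw.
  have [u0|u0] := eqVneq u 0; [right; exists alpha, v|left; exists alpha, u]; split => //.
  by split => //; move: w0; rewrite wE u0 add0r.
- apply/seteqP; split => chi //= -[Ichi Jchi].
  (* A root common to both pieces would be orthogonal to itself, against positivity. *)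
  have := orth _ _ Ichi Jchi; have [alpha [u [ra ar a0 [Hu u0 _]]]] := Ichi.
  by move: a0; rewrite -ar => a0 H; have := pos _ _ ra a0 Hu u0; rewrite H ltxx.
Qed.

End SimpleIrreducible.

Theorem theorem1p6 (R : realType) (g0 : vectType R) (br : g0 -> g0 -> g0)
    (A : set 'End(g0)) (m : 'End(g0) -> 'End(g0) -> R)
    (br_lie : is_lie_bracket br)
    (br_compact : compact_semisimple br)
    (A_star : star_subgroup (lie_aut br) A)
    (m_metric : biinvariant_metric (lie_aut br) m)
    (g_eq_infty : g_infty br A = [set: cplx g0]) :
  A_simple br A <-> irreducible_roots m (id_comp A) (res_roots A).
Proof.
split; first exact: irreducible_of_simple.
exact: simple_of_irreducible.
Qed.
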